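(* Let $(M,\xi)$ be a compact contact manifold and let $\{X_t\}$, $t\in[0,1]$, be a smooth homotopy through Reeb vector fields on $(M,\xi)$. Let $S=S(\{X_t\})$. Then there is no locally Lipschitz continuous map $p:[0,\infty)\to S$ such that $p$ is unbounded from above and the composition $\pi_3\circ p:[0,\infty)\to[0,1]$ has finite length, where $\pi_3:LM\times(0,\infty)\times[0,1]\to[0,1]$ is the projection.
   Context: A smooth homotopy through Reeb vector fields on $(M,\xi)$ is a smooth family $\{X_t\}$ of vector fields such that each $X_t$ is the Reeb vector field of a contact form $\lambda_t=f_t\lambda$, $f_t>0$, where $\lambda$ is a fixed contact form with $\ker\lambda=\xi$. Let $LM$ be the free loop space of $M$ and $$S(\{X_t\})=\{(o,p,t)\in LM\times(0,\infty)\times[0,1] \mid o:\mathbb{R}/\mathbb{Z}\to M \text{ is non-constant and } \dot o(s)=p\,X_t(o(s)) \text{ for all } s\}.$$ Thus the second coordinate is a (not necessarily least) period of the corresponding closed orbit of $X_t$. The space $S$ has the topology, and the metric up to local Lipschitz equivalence, induced by the embedding $S\hookrightarrow M\times(0,\infty)\times[0,1]$, $(o,p,t)\mapsto(o(0),p,t)$, where $M$ carries any Riemannian metric (equivalently, $LM$ carries the uniform metric). A map to $S$ is unbounded from above if its composition with the projection to $(0,\infty)$ is unbounded from above. A locally Lipschitz map $q:[0,\infty)\to[0,1]$ has finite length if $\int_0^\infty|\dot q|\,d\tau<\infty$, where $|\dot q|(\tau_0)=\limsup_{s\to\tau_0}|q(\tau_0)-q(s)|/|\tau_0-s|$. *)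

(* Defs.v *)
From HB Require Import structures.
From mathcomp Require Export all_boot all_order all_algebra.
From mathcomp Require Export fingroup perm.
From mathcomp Require Export all_classical all_reals all_analysis.
Export Order.TTheory GRing.Theory Num.Theory.
Export numFieldNormedType.Exports.

Set Implicit Arguments.
Unset Strict Implicit.
Unset Printing Implicit Defensive.

Local Open Scope classical_set_scope.
Local Open Scope ring_scope.

Section Smoothness.
Context {R : realType} {V W : normedModType R}.

(* C^k on an open set U; for finite-dimensional V this is the usual notion *)
Fixpoint Ck (k : nat) (U : set V) (f : V -> W) : Prop :=
  if k is k'.+1 then
    (forall x, U x -> differentiable f x) /\ (forall v, Ck k' U ('D_v f))
  else forall x, U x -> {for x, continuous f}.

Definition smooth (U : set V) (f : V -> W) := forall k, Ck k U f.

(* On an arbitrary set A, regularity at x means that f agrees on A, near x,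
   with a function which is regular on an open neighbourhood of x. *)
Definition extends_at (P : set V -> (V -> W) -> Prop) (A : set V) (f : V -> W)
    (x : V) :=
  exists (U : set V) (h : V -> W),
    [/\ open U, U x, P U h & forall y, U y -> A y -> f y = h y].

Definition smooth_on (A : set V) (f : V -> W) :=
  forall x, A x -> extends_at smooth A f x.

End Smoothness.

(* A smooth n-manifold without boundary. The atlas is indexed by the points:
   [coord c] is a chart around c, with domain [dom c] and inverse [inv c].
   As [c] ranges over the manifold the charts form an atlas, and every smooth
   structure admits such an atlas. *)
Record manifold (R : realType) (n : nat) := Manifold {
  carrier :> topologicalType;
  dom : carrier -> set carrier;
  coord : carrier -> carrier -> 'rV[R]_n;
  inv : carrier -> 'rV[R]_n -> carrier;
  carrier_hausdorff : hausdorff_space carrier;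
  carrier_second_countable : @second_countable carrier;
  mem_dom : forall c, dom c c;
  open_dom : forall c, open (dom c);
  open_coord : forall c, open (coord c @` dom c);
  coordK : forall c x, dom c x -> inv c (coord c x) = x;
  continuous_coord : forall c x, dom c x -> {for x, continuous (coord c)};
  continuous_inv : forall c y, (coord c @` dom c) y ->
    {for y, continuous (inv c)};
  smooth_transition : forall c d,
    smooth (coord c @` (dom c `&` dom d)) (coord d \o inv c)
}.

Section Tensors.
Context {R : realType} {n : nat} {M : manifold R n}.

(* The tangent space T_x M is 'rV[R]_n, a vector being given by its components
   in the chart [coord x]; dually, covectors at x are columns. Thus a vector
   field is a map M -> 'rV[R]_n, a 1-form is a map M -> 'cV[R]_n, and a field
   of bilinear forms is a map M -> 'M[R]_n. The next two functions convert
   between components in [coord x] and components in another chart. *)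
Definition to_chart (c x : M) (v : 'rV[R]_n) : 'rV[R]_n :=
  'd (coord c \o inv x) (coord x x) v.

Definition from_chart (c x : M) (w : 'rV[R]_n) : 'rV[R]_n :=
  'd (coord x \o inv c) (coord c x) w.

Definition pairing (a : 'cV[R]_n) (v : 'rV[R]_n) : R := (v *m a) 0 0.

Definition bilin (g : 'M[R]_n) (u v : 'rV[R]_n) : R := (u *m g *m v^T) 0 0.

(* y |-> lambda(w), with w a constant vector in the coordinates of the chart c *)
Definition form_coef (lambda : M -> 'cV[R]_n) (c : M) (w : 'rV[R]_n)
    (y : 'rV[R]_n) : R :=
  pairing (lambda (inv c y)) (from_chart c (inv c y) w).

Definition smooth_form_on (U : set M) (lambda : M -> 'cV[R]_n) :=
  forall c w, smooth (coord c @` (dom c `&` U)) (form_coef lambda c w).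

(* (d lambda)_x(u, v), computed in the chart [coord x] with u and v extended
   as constant vector fields *)
Definition dform (lambda : M -> 'cV[R]_n) (x : M) (u v : 'rV[R]_n) : R :=
  'D_u (form_coef lambda x v) (coord x x)
  - 'D_v (form_coef lambda x u) (coord x x).

(* Smooth family of vector fields X t, t in [0, 1] *)
Definition smooth_family (X : R -> M -> 'rV[R]_n) :=
  forall c : M,
    smooth_on ((coord c @` dom c) `*` [set` `[0%R, 1%R] : interval R])
      (fun z : 'rV[R]_n * R =>
         to_chart c (inv c z.1) (X z.2 (inv c z.1))).

Definition riemannian_metric (g : M -> 'M[R]_n) :=
  [/\ forall x, (g x)^T = g x,
      forall x v, v != 0 -> 0 < bilin (g x) v v
    & forall c u w, smooth (coord c @` dom c)
        (fun y => bilin (g (inv c y))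
           (from_chart c (inv c y) u) (from_chart c (inv c y) w))].

Definition C1_path (gamma : R -> M) :=
  {within `[0%R, 1%R], continuous gamma} /\
  (forall s, s \in `[0%R, 1%R] ->
     extends_at (Ck 1) [set` `[0%R, 1%R] : interval R]
       (coord (gamma s) \o gamma) s).

Definition velocity (gamma : R -> M) (s : R) : 'rV[R]_n :=
  'D_1 (coord (gamma s) \o gamma) s.

Definition path_length (g : M -> 'M[R]_n) (gamma : R -> M) : \bar R :=
  (\int[lebesgue_measure]_(s in `[0%R, 1%R])
     (Num.sqrt (bilin (g (gamma s)) (velocity gamma s) (velocity gamma s)))%:E)%E.

(* Infimum of lengths of C^1 paths; +oo between points of distinct components *)
Definition riemannian_dist (g : M -> 'M[R]_n) (x y : M) : \bar R :=
  ereal_inf [set path_length g gamma | gamma in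
    [set gamma | [/\ C1_path gamma, gamma 0 = x & gamma 1 = y]]].

(* A loop R/Z -> M, as a 1-periodic map *)
Record loop := Loop {
  loop_fun :> R -> M;
  loop_continuous : continuous loop_fun;
  loop_periodic : forall s, loop_fun (s + 1) = loop_fun s
}.

Definition orbit_space (X : R -> M -> 'rV[R]_n) : set (loop * R * R) :=
  [set z : loop * R * R | let: (o, p, t) := z in
    [/\ 0 < p, 0 <= t <= 1, exists s s', o s <> o s'
      & forall s, is_derive s (1 : R) (coord (o s) \o o) (p *: X t (o s))]].

(* A product metric for the embedding (o, p, t) |-> (o 0, p, t) *)
Definition orbit_dist (g : M -> 'M[R]_n) (z z' : loop * R * R) : \bar R :=
  (riemannian_dist g (z.1.1 0%R) (z'.1.1 0%R)
   + `|z.1.2 - z'.1.2|%:E + `|z.2 - z'.2|%:E)%E.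

End Tensors.

Arguments loop {R n} M.

Section Contact.
Context {R : realType} {m : nat} {M : manifold R m.*2.+1}.

(* (lambda /\ (d lambda)^m)_x (e_0, ..., e_2m), up to a positive factor *)
Definition contact_volume (lambda : M -> 'cV[R]_(m.*2.+1)) (x : M) : R :=
  let e (s : 'S_(m.*2.+1)) (i : nat) : 'rV[R]_(m.*2.+1) :=
    delta_mx 0 (s (inord i)) in
  \sum_(s : 'S_(m.*2.+1)) (-1) ^+ s * (pairing (lambda x) (e s 0%N) *
     \prod_(k < m) dform lambda x (e s k.*2.+1) (e s k.*2.+2)).

Definition contact_form_on (U : set M) (lambda : M -> 'cV[R]_(m.*2.+1)) :=
  smooth_form_on U lambda /\ (forall x, U x -> contact_volume lambda x != 0).

Definition contact_form := contact_form_on [set: M].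

Definition kernel_on (U : set M) (lambda : M -> 'cV[R]_(m.*2.+1))
    (xi : M -> set 'rV[R]_(m.*2.+1)) :=
  forall x, U x -> xi x = [set v | pairing (lambda x) v = 0].

Definition contact_structure (xi : M -> set 'rV[R]_(m.*2.+1)) :=
  forall x, exists (U : set M) (alpha : M -> 'cV[R]_(m.*2.+1)),
    [/\ open U, U x, contact_form_on U alpha & kernel_on U alpha xi].

Definition reeb_field (lambda : M -> 'cV[R]_(m.*2.+1))
    (X : M -> 'rV[R]_(m.*2.+1)) :=
  forall x, pairing (lambda x) (X x) = 1 /\
            (forall v, dform lambda x (X x) v = 0).

(* Smoothness of f is implied by that of lambda and f *: lambda. *)
Definition reeb_homotopy (xi : M -> set 'rV[R]_(m.*2.+1))
    (X : R -> M -> 'rV[R]_(m.*2.+1)) :=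
  smooth_family X /\
  exists lambda : M -> 'cV[R]_(m.*2.+1),
    [/\ contact_form lambda, kernel_on [set: M] lambda xi
      & forall t, 0 <= t <= 1 -> exists f : M -> R,
          [/\ forall x, 0 < f x,
              contact_form (fun x => f x *: lambda x)
            & reeb_field (fun x => f x *: lambda x) (X t)]].

End Contact.

Section HalfLine.
Context {R : realType}.

Definition locally_lipschitz {T : Type} (dist : T -> T -> \bar R) (p : R -> T) :=
  forall a, 0 <= a -> exists e L : R, 0 < e /\
    forall b c, 0 <= b -> 0 <= c -> `|b - a| < e -> `|c - a| < e ->
      (dist (p b) (p c) <= (L * `|b - c|)%:E)%E.

(* limsup over s -> a with s != a and 0 <= s, as q only matters on [0, +oo[ *)
Definition metric_derivative (q : R -> R) (a : R) : \bar R :=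
  limf_esup (fun s => (`|q a - q s| / `|a - s|)%:E) (within [set s | 0 <= s] a^').

Definition finite_length (q : R -> R) :=
  (\int[lebesgue_measure]_(a in `[0%R, +oo[) metric_derivative q a < +oo)%E.

End HalfLine.

(* Main.v *)
Require Import Defs.
From mathcomp Require Import measurable_realfun lebesgue_measure.
From mathcomp Require Import ring lra.

Set Implicit Arguments.
Unset Strict Implicit.
Unset Printing Implicit Defensive.

Local Open Scope classical_set_scope.
Local Open Scope ring_scope.

(** The period of a closed orbit of the Reeb field of a contact form is its
    action, the integral of the form along the orbit. Let (o, p, t) move along
    a path of closed orbits, o being an orbit of the Reeb field X_t of
    lambda_t = f_t lambda. Since X_t lies in the kernel of d lambda_t, closed
    orbits are critical points of the action: moving o does not change the
    integral of lambda_t to first order, and only the variation of the form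
    itself contributes to the variation of p. As d/dt lambda_t is the product
    of d/dt (log f_t) with lambda_t, this gives |d (log p)| <= C |dt|, where C
    bounds |d/dt (log f_t)| on the compact space M x [0, 1]. Hence the
    variation of log p is controlled by the length of t, and p is bounded when
    that length is finite.

    The space of closed orbits need not be a manifold and the path is only
    Lipschitz, so the first variation is computed for nearby pairs of orbits.
    If closed orbits (o_i, p_i, t_i) tend to (o, p, t), with initial points,
    periods and parameters at distance O(eps_i), then
    |p_i - p| <= C p_i |t_i - t| + o(eps_i); this is [period_variation].
    By a Gronwall-type estimate, carried from chart to chart, o_i stays within
    O(eps_i) of o during the whole turn ([close_locally_uniformly]). Consider
    then [boundary_term], the value at o(s) of the form alpha = lambda_t on the
    displacement from o(s) to o_i(s). In a chart, its derivative in s is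
    alpha(d o_i/ds) - alpha(d o/ds) plus a term that d alpha(X_t, .) = 0 makes
    small compared with eps_i ([first_variation_integrand]); so it grows like
    (p_i - p) s, up to the error above, and yet it returns to its initial value
    after one turn. The tangent space at x is described by the chart of x, and
    so is the condition on d alpha at x. It is used at one tag in each of
    finitely many short intervals of time, where it holds approximately by
    continuity; Cousin's lemma, [interval_additive_induction], provides these
    intervals.

    Two tools connect infinitesimal and global estimates. If the difference
    quotients of a Lipschitz function are asymptotically at most G, then its
    increments are at most the integral of G, even when the integral of G is
    only a lower one ([increment_le_integral]). This is applied to log p and
    the metric derivative of t, and also to the coordinates of a C^1 path and
    its speed, which shows that the Riemannian distance dominates the distance
    in a chart ([riemannian_dist_chart]). Secondly, f_t is only known for each
    t separately, but 1 / f_t = lambda(X_t) inherits the smoothness of lambda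
    and X; compactness then yields C ([pairing_log_lipschitz]). *)

(** * Increments of Lipschitz functions and lower integrals *)

(** Holds for arbitrary nonnegative functions, because their integral is a
    supremum over the simple functions below them. *)
Lemma ge0_integral_mono (R : realType) (A B : set R) (f g : R -> \bar R) :
  A `<=` B -> (forall x, A x -> (0 <= f x)%E) -> (forall x, B x -> (0 <= g x)%E) ->
  (forall x, A x -> (f x <= g x)%E) ->
  (\int[lebesgue_measure]_(x in A) f x <= \int[lebesgue_measure]_(x in B) g x)%E.
Proof.
move=> AB f0 g0 fg; rewrite ge0_integralE// ge0_integralE//.
apply: ge_ereal_sup => _ [h hf <-]; apply: ereal_sup_ubound.
exists h => // x; apply: le_trans (hf x) _.
rewrite /patch; case: ifPn => [|xA]; first by rewrite inE => xA; rewrite mem_set; [exact: fg|exact: AB].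
by case: ifPn => // xB; apply: g0; rewrite inE in xB.
Qed.

Section IncrementIntegral.
Context {R : realType}.
Let mu := (@lebesgue_measure R).

Let primitive (F : R -> R) (a : R) : continuous F ->
  exists Phi : R -> R, forall x, a < x -> derivable Phi x 1 /\ derive1 Phi x = F x.
Proof.
move=> cF; exists (fun x => \int[mu]_(t in `[a, x]) F t)%R => x ax.
apply: (@continuous_FTC1_closed _ F a x (x + 1)) => //.
- by rewrite ltrDl.
- apply: continuous_compact_integrable; first exact: segment_compact.
  exact: continuous_subspaceT.
- exact: cF.
Qed.

(** The mean over ]a, b[ of the quotients (F (x + h) - F x) / h tends to
    F b - F a as h tends to 0, since a primitive of F is differentiable at a and
    b; and the upper limit of the means is at most the integral of the upper
    limit of the absolute quotients, by dominated convergence for the suprema of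
    their tails. *)
Lemma lipschitz_increment_le_integral (F : R -> R) (G : R -> \bar R) (a b K : R) :
  a < b -> (forall x y, `|F x - F y| <= K * `|x - y|) ->
  (forall x, a < x < b -> (0 <= G x)%E) ->
  (forall x, a < x < b -> forall k : R, (G x < k%:E)%E ->
     \forall n \near \oo, n.+1%:R * `|F (x + n.+1%:R^-1) - F x| <= k) ->
  (`|F b - F a|%:E <= \int[mu]_(x in `]a, b[) G x)%E.
Proof.
move=> ab FK G0 FG.
have K0 : 0 <= K by have := FK 1 0; rewrite subr0 normr1 mulr1; apply: le_trans.
have cF : continuous F.
  move=> x; apply/cvgrPdist_le => e e0; near=> y.
  apply: le_trans (FK _ _) _.
  have : `|x - y| <= e / (K + 1).
    near: y; have e1 : 0 < e / (K + 1) by rewrite divr_gt0// ltr_wpDl.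
    by move/cvgrPdist_le : (@cvg_id _ (nbhs x)) => /(_ _ e1).
  rewrite ler_pdivlMr ?ltr_wpDl// mulrC; apply: le_trans.
  by rewrite ler_wpM2r// lerDl.
have [Phi dPhi] := primitive (a - 1) cF.
have dP x : a <= x -> is_derive x 1 Phi (F x).
  move=> ax; have [|d1 d2] := dPhi x; first by rewrite ltrBlDr ltr_pwDr.
  by rewrite -d2 derive1E; apply/derivableP.
pose h n : R := n.+1%:R^-1.
have h0 n : 0 < h n by rewrite invr_gt0.
pose D n x := n.+1%:R * (F (x + h n) - F x).
pose Psi n x := n.+1%:R * (Phi (x + h n) - Phi x).
have cD n : continuous (D n).
  move=> x; apply: cvgM; first exact: cvg_cst.
  apply: cvgB; last exact: cF.
  by apply: (@continuous_comp _ _ _ (fun x => x + h n) F); [apply: cvgD; [exact: cvg_id|exact: cvg_cst]|exact: cF].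
have dPsi n x : a <= x -> is_derive x 1 (Psi n) (D n x).
  move=> ax; rewrite /Psi /D.
  have axh : a <= x + h n by rewrite (le_trans ax)// lerDl ltW.
  have H1 : is_derive x 1 (fun y => Phi (y + h n)) (F (x + h n)).
    have := dP _ axh => ?.
    have Hs : is_derive x 1 (fun y : R => y + h n) 1.
      by have := @is_deriveD R _ _ id (cst (h n)) x 1 1 0 _ _; rewrite addr0; exact.
    have := @is_derive1_comp R Phi (fun y : R => y + h n) x (F (x + h n)) 1 _ Hs.
    by rewrite mulr1; exact.
  have H2 := dP x ax.
  exact: (@is_deriveZ _ _ _ (fun y => Phi (y + h n) - Phi y) n.+1%:R x 1 _ (@is_deriveB _ _ _ _ _ _ _ _ _ H1 H2)).
have cPsi n x : a <= x -> {for x, continuous (Psi n)}.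
  by move=> /(dPsi n)[/derivable1_diffP /differentiable_continuous].
have intD n : (\int[mu]_(x in `[a, b]) (D n x)%:E = (Psi n b)%:E - (Psi n a)%:E)%E.
  apply: continuous_FTC2 => //.
  - exact: continuous_subspaceT.
  - split.
    + by move=> x; rewrite in_itv/= => /andP[/ltW/(dPsi n)[]].
    + by apply: cvg_at_right_filter; exact: (cPsi _ _ (lexx a)).
    + by apply: cvg_at_left_filter; exact: (cPsi _ _ (ltW ab)).
  - move=> x; rewrite in_itv/= => /andP[/ltW ax _].
    by rewrite derive1E; have [] := dPsi n x ax.
have cvgPsi x : a <= x -> Psi n x @[n --> \oo] --> F x.
  move=> /dP[dx <-].
  have := dx; rewrite /derivable /derive => /cvg_ex[l] Hl.
  rewrite (cvg_lim _ Hl)//.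
  have hd : h n @[n --> \oo] --> (0 : R)^'.
    move=> A /= [e e0 eA].
    have := @cvg_harmonic R; move/cvgrPdist_lt => /(_ e e0); apply: filterS => k.
    by rewrite sub0r normrN => kh; apply: eA => //=; rewrite ?sub0r ?normrN// gt_eqF.
  have := cvg_comp _ _ hd Hl; apply: cvg_trans; apply: near_eq_cvg; near=> k => /=.
  by rewrite /Psi /h invrK /shift/= /GRing.scale/= mulr1 (addrC x).
  Unshelve. all: end_near.
pose d n x : \bar R := (`|D n x|)%:E.
have dK n x : (d n x <= K%:E)%E.
  rewrite lee_fin normrM normr_nat -ler_pdivlMl ?ltr0n//.
  by apply: le_trans (FK _ _) _; rewrite addrC addKr gtr0_norm// mulrC.
have d0 n x : (0 <= d n x)%E by rewrite lee_fin.
have md n : measurable_fun (setT : set (measurableTypeR R)) (d n).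
  apply: measurableT_comp => //; apply: continuous_measurable_fun => x.
  by apply: (@continuous_comp _ _ _ (D n) Num.norm); [exact: cD|exact: norm_continuous].
pose s n (x : measurableTypeR R) := esups (d ^~ x) n.
have ms n : measurable_fun `]a, b[ (s n).
  by apply: measurable_fun_esups => k; apply: measurable_funTS; exact: md.
have sK n x : (`|s n x| <= K%:E)%E.
  rewrite gee0_abs.
    by apply: ge_ereal_sup => _ [k _ <-]; exact: dK.
  apply: le_trans (d0 n x) _; apply: ereal_sup_ubound; exists n => //=.
have ds n x : (d n x <= s n x)%E by apply: ereal_sup_ubound; exists n => //=.
have [] := @dominated_convergence _ _ _ mu `]a, b[ (measurable_itv _) s
  (fun x => limn_esup (d ^~ x)) (cst K%:E).
- exact: ms.
- by apply: measurable_fun_limn_esup => k; apply: measurable_funTS; exact: md.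
- apply: aeW => x _; rewrite limn_esup_lim; exact: is_cvg_esups.
- apply: (@integrableS _ _ _ mu `[a, b]) => //; first exact: subset_itv_oo_cc.
  apply: (@continuous_compact_integrable _ (cst K)); first exact: segment_compact.
  by apply: continuous_subspaceT => x; exact: cvg_cst.
- by apply: aeW => x n _.
move=> _ _ cvgs.
apply: (@le_trans _ _ (\int[mu]_(x in `]a, b[) limn_esup (d ^~ x))%E); last first.
  apply: ge0_integral_mono => // x xab; rewrite /= in_itv/= in xab.
  - by rewrite limn_esup_lim; apply: lime_ge; [exact: is_cvg_esups|apply: nearW => n; apply: le_trans (ds n x)].
  - have := G0 x xab; case Gx : (G x) => [r| |] // _; last by rewrite leey.
    apply/lee_addgt0Pr => e e0.
    have /(_ (r + e)) := FG x xab; rewrite Gx lte_fin ltrDl e0 => /(_ isT) near_d.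
    apply: (@le_trans _ _ (ereal_sup (d ^~ x @` [set n | (d n x <= (r + e)%:E)%E]))).
      apply: ereal_inf_lbound; exists [set n | (d n x <= (r + e)%:E)%E] => //.
      apply: filterS near_d => n /= nx.
      by rewrite lee_fin /D normrM normr_nat.
    by apply: ge_ereal_sup => _ [n /= + <-].
have cvgL : (`|Psi n b - Psi n a|%:E @[n --> \oo] --> `|F b - F a|%:E)%E.
  apply: cvg_EFin; first by apply: nearW.
  by apply: cvg_norm; apply: cvgB; apply: cvgPsi => //; exact: ltW.
apply: (lee_cvg_to cvgL cvgs); apply: nearW => n.
have -> : (`|Psi n b - Psi n a|%:E = `|\int[mu]_(x in `]a, b[) (D n x)%:E|)%E.
  rewrite -(integral_itv_bndoo true false) ?intD//.
  by apply: measurable_funTS; apply: measurableT_comp => //; exact: continuous_measurable_fun.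
apply: (le_trans (le_abse_integral _ _ _)) => //.
  by apply: measurable_funTS; apply: measurableT_comp => //; exact: continuous_measurable_fun.
apply: ge0_integral_mono => // x _; last exact: ds.
exact: le_trans (d0 n x) (ds n x).
Unshelve. all: by end_near.
Qed.
End IncrementIntegral.

Section Intervals.
Context {R : realType}.

(** The supremum of the points up to which [P] holds satisfies [P] by the last
    hypothesis, and cannot be smaller than [b] by the previous one. *)
Lemma real_induction (P : R -> Prop) (a b : R) :
  a <= b -> P a ->
  (forall s, a <= s < b -> P s ->
     exists2 d, 0 < d & forall s', s < s' < s + d -> s' <= b -> P s') ->
  (forall s, a < s <= b -> (forall s', a <= s' < s -> P s') -> P s) ->
  forall s, a <= s <= b -> P s.
Proof.
move=> ab Pa Pr Pl.
pose E := [set s | a <= s <= b /\ forall s', a <= s' <= s -> P s'].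
have Ea : E a by split=> [|s' /le_anti <-//]; rewrite lexx.
have ubE : ubound E b by move=> s [/andP[]].
have supE : has_sup E by split; [exists a|exists b].
pose t := sup E.
have at_ : a <= t by apply: ub_le_sup => //; exists b.
have tb : t <= b by apply: ge_sup => //; exists a.
have Pt' s' : a <= s' < t -> P s'.
  move=> /andP[as' s't]; have [e [eab eP] s'e] := sup_gt (proj1 supE) s't.
  by apply: eP; rewrite as' ltW.
have Pt : P t.
  move: at_; rewrite le_eqVlt => /orP[/eqP<-//|at_].
  by apply: Pl => //; rewrite at_.
have Pt'' s' : a <= s' <= t -> P s'.
  move=> /andP[as']; rewrite le_eqVlt => /orP[/eqP->//|s't].
  by apply: Pt'; rewrite as'.
move: tb; rewrite le_eqVlt => /orP[/eqP<-//|tb].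
have [|d d0 dP] := Pr t _ Pt; first by rewrite at_.
pose m := Num.min b (t + d / 2).
have tm : t < m by rewrite lt_min tb ltrDl divr_gt0.
suff : E m by move/(ub_le_sup (ex_intro _ b ubE)); rewrite leNgt tm.
split; first by rewrite ge_min lexx andbT (le_trans at_)// ltW.
move=> s' /andP[as' s'm]; have [s't|ts'] := leP s' t; first by apply: Pt''; rewrite as'.
move: s'm; rewrite le_min => /andP[s'b s'd]; apply: dP => //.
by rewrite ts'/= (le_lt_trans s'd)// ltrD2l; lra.
Qed.

(** Cousin's lemma: a property of intervals which is additive, and which holds
    for all small intervals around each tag t, holds for the whole interval. *)
Lemma interval_additive_induction (Q : R -> R -> Prop) (a b : R) : a < b ->
  (forall x y z, a <= x -> x < y -> y < z -> z <= b -> Q x y -> Q y z -> Q x z) ->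
  (forall t, a <= t <= b -> exists2 d, 0 < d &
     forall x y, a <= x -> x <= t -> t <= y -> y <= b -> x < y ->
       t - d < x -> y < t + d -> Q x y) ->
  Q a b.
Proof.
move=> ab Qadd Qloc.
suff H : forall s, a <= s <= b -> s = a \/ Q a s.
  have [|ba|//] := H b; first by rewrite lexx ltW.
  by move: ab; rewrite ba ltxx.
apply: real_induction; first exact: ltW; first by left.
- move=> s /andP[as_ sb] Hs; have [|d d0 dQ] := Qloc s; first by rewrite as_ ltW.
  exists d => // s' /andP[ss' s'd] s'b; right.
  have Qss' : Q s s' by apply: dQ => //; [exact: ltW|rewrite ltrBlDr ltrDl].
  case: Hs => [<-//|Qas]; move: as_; rewrite le_eqVlt => /orP[/eqP->//|as_].
  by apply: (Qadd a s s').
- move=> s /andP[as_ sb] Hs; right.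
  have [|d d0 dQ] := Qloc s; first by rewrite sb ltW.
  pose x := Num.max a (s - d / 2).
  have ax : a <= x by rewrite le_max lexx.
  have xs : x < s by rewrite gt_max as_/=; lra.
  have sdx : s - d < x by rewrite lt_max; apply/orP; right; lra.
  have Qxs : Q x s by apply: dQ => //; [exact: ltW|rewrite ltrDl].
  have [|<-//|Qax] := Hs x; first by rewrite ax.
  move: ax; rewrite le_eqVlt => /orP[/eqP->//|ax].
  exact: (Qadd a x s).
Qed.

Lemma lipschitz_of_locally (F : R -> R) (a b : R) : a < b ->
  (forall t, a <= t <= b -> exists d K, 0 < d /\
     forall x y, a <= x <= b -> a <= y <= b -> `|x - t| < d -> `|y - t| < d ->
       `|F x - F y| <= K * `|x - y|) ->
  exists K, forall x y, a <= x <= b -> a <= y <= b -> `|F x - F y| <= K * `|x - y|.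
Proof.
move=> ab Floc.
pose Q x y := exists K, forall u v, x <= u -> u <= v -> v <= y -> `|F u - F v| <= K * (v - u).
suff [K KP] : Q a b.
  exists K => x y /andP[ax xb] /andP[ay yb].
  have [xy|yx] := leP x y; first by rewrite (ler0_norm (_ : x - y <= 0)) ?subr_le0// opprB KP.
  by rewrite distrC (gtr0_norm (_ : 0 < x - y)) ?subr_gt0// KP// ltW.
apply: interval_additive_induction => //.
- move=> x y z ax xy yz zb [K KP] [L LP]; exists (Num.max K L) => u v xu uv vz.
  have mono c u' v' : u' <= v' -> c <= Num.max K L -> c * (v' - u') <= Num.max K L * (v' - u').
    by move=> uv' cm; rewrite ler_wpM2r// subr_ge0.
  have Km : K <= Num.max K L by rewrite le_max lexx.
  have Lm : L <= Num.max K L by rewrite le_max lexx orbT.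
  have [vy|yv] := leP v y; first by apply: le_trans (KP _ _ _ _ _) (mono _ _ _ _ _).
  have [yu|uy] := leP y u; first by apply: le_trans (LP _ _ _ _ _) (mono _ _ _ _ _).
  have -> : v - u = (y - u) + (v - y) by lra.
  rewrite mulrDr; apply: le_trans (lerD (le_trans (KP u y _ _ _) (mono _ _ _ _ Km))
    (le_trans (LP y v _ _ _) (mono _ _ _ _ Lm))) => //; try exact: ltW.
  by rewrite (_ : F u - F v = (F u - F y) + (F y - F v)) ?ler_normD//; lra.
- move=> t /Floc[d [K [d0 dK]]]; exists d => // x y ax xt ty yb xy tdx ytd.
  exists K => u v xu uv vy; rewrite -(ger0_norm (_ : 0 <= v - u)) ?subr_ge0// (distrC v).
  have near w : u <= w -> w <= v -> `|w - t| < d.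
    by move=> uw wv; rewrite ltr_distl; apply/andP; split; lra.
  by apply: dK; [lra|lra|apply: near..].
Qed.

(** Reduces to a function which is Lipschitz on the line, by extending F with
    constants on both sides of the interval. *)
Lemma increment_le_integral (F : R -> R) (G : R -> \bar R) (a b : R) : a < b ->
  (forall t, a <= t <= b -> exists d K, 0 < d /\
     forall x y, a <= x <= b -> a <= y <= b -> `|x - t| < d -> `|y - t| < d ->
       `|F x - F y| <= K * `|x - y|) ->
  (forall x, a < x < b -> (0 <= G x)%E) ->
  (forall x, a < x < b -> forall k : R, (G x < k%:E)%E ->
     \forall y \near x, `|F y - F x| <= k * `|y - x|) ->
  (`|F b - F a|%:E <= \int[lebesgue_measure]_(x in `]a, b[) G x)%E.
Proof.
move=> ab /(lipschitz_of_locally ab)[K FK] G0 FG.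
pose c x := Num.max a (Num.min b x).
have cin x : a <= c x <= b by rewrite le_max lexx/= ge_max ge_min lexx (ltW ab).
have cE x : a <= x <= b -> c x = x by move=> /andP[ax xb]; rewrite /c min_r// max_r.
have c1 x y : `|c x - c y| <= `|x - y|.
  wlog xy : x y / x <= y.
    by move=> H; have [/H//|/ltW/H] := leP x y; rewrite distrC (distrC y).
  have : 0 <= c y - c x <= y - x.
    rewrite /c /Num.max /Num.min.
    have [?|?] := ltP b x; have [?|?] := ltP b y; rewrite ?ab;
      have [?|?] := ltP a x; have [?|?] := ltP a y; lra.
  move=> /andP[c0 cxy]; rewrite distrC (ger0_norm c0) distrC ger0_norm//; lra.
have K0 : 0 <= K.
  have := FK b a; rewrite !lexx (ltW ab) => /(_ isT isT)/(le_trans (normr_ge0 _)).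
  by rewrite pmulr_lge0// normr_gt0 subr_eq0 gt_eqF.
have := @lipschitz_increment_le_integral _ (F \o c) G a b K ab _ G0.
rewrite /= !cE ?lexx ?(ltW ab)//; apply=> [x y|x xab k Gk].
  by apply: le_trans (FK _ _ (cin x) (cin y)) _; rewrite ler_wpM2l.
have := FG x xab k Gk => /nbhs_ballP[e /= e0 eF].
have bx : 0 < Num.min e (b - x) by rewrite lt_min e0/= subr_gt0; lra.
have := @cvg_harmonic R; move/cvgrPdist_lt => /(_ _ bx); apply: filterS => n.
have n0 : 0 < n.+1%:R^-1 :> R by rewrite invr_gt0.
rewrite sub0r normrN /= gtr0_norm// lt_min => /andP[ne nb].
set h := n.+1%:R^-1 in n0 ne nb *; have /andP[ax xb] := xab.
rewrite !cE; [|by apply/andP; split; lra..]; rewrite -ler_pdivlMl ?ltr0n// mulrC.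
have /eF : ball x e (x + h) by rewrite /ball/= opprD addrA subrr sub0r normrN gtr0_norm.
by rewrite /= (addrAC x) subrr add0r (gtr0_norm n0).
Qed.

End Intervals.

(** * Calculus in finite-dimensional normed spaces *)

Section RowNorm.
Context {R : realType} {n : nat}.

Lemma le_row_norm (v : 'rV[R]_n) (B : R) :
  0 <= B -> (forall j, `|v 0 j| <= B) -> `|v| <= B.
Proof.
move=> B0 vB; rewrite [leLHS]/Num.Def.normr/= mx_normrE (bigmax_le _ B0)//= => -[i j] _.
by rewrite (ord1 i).
Qed.

Lemma coord_le_norm (v : 'rV[R]_n) j : `|v 0 j| <= `|v|.
Proof.
rewrite [leRHS]/Num.Def.normr/= mx_normrE.
exact: (@le_bigmax _ _ _ 0 (fun i : 'I_1 * 'I_n => `|v i.1 i.2|) (0, j)).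
Qed.

End RowNorm.

Section Calculus.
Context {R : realType}.

Lemma near_dist_lt (V : normedModType R) (x : V) (e : R) : 0 < e ->
  \forall y \near x, `|y - x| < e.
Proof. by move=> e0; apply/nbhs_normP; exists e => // y; rewrite /= distrC. Qed.

Lemma differentiable_eps (V W : normedModType R) (f : V -> W) (x : V) (e : R) :
  differentiable f x -> 0 < e ->
  \forall y \near x, `|f y - f x - 'd f x (y - x)| <= e * `|y - x|.
Proof.
move=> df e0; have /diff_locallyP[_ /eqaddoP/(_ e e0)] := df.
rewrite [X in _ -> X](near_shift 0 x) subr0 near_simpl; apply: filterS => h /=.
by rewrite /= addrK !fctE opprD addrA.
Qed.

Lemma is_derive_comp_diff (V W : normedModType R) (f : V -> W) (g : R -> V) (s : R) (v : V) :
  differentiable f (g s) -> is_derive s 1 g v -> is_derive s 1 (f \o g) ('d f (g s) v).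
Proof.
move=> df [dg <-].
have dg' : differentiable g s by apply/derivable1_diffP.
have dfg : differentiable (f \o g) s by apply: differentiable_comp.
apply: DeriveDef; first exact/derivable1_diffP.
by rewrite deriveE// diff_comp//= deriveE.
Qed.

Lemma segment_mean_value (V : normedModType R) (h : V -> R) (x y : V) :
  (forall s : R, 0 <= s <= 1 -> differentiable h (x + s *: (y - x))) ->
  exists2 s : R, 0 <= s <= 1 & h y - h x = 'd h (x + s *: (y - x)) (y - x).
Proof.
move=> dh; pose g s := x + s *: (y - x).
have dg s : is_derive s (1 : R) g (y - x).
  have Hl : is_derive s (1 : R) (fun s => s *: (y - x)) (y - x).
    have := @is_diff_scalel _ V s (y - x) => dl.
    apply: DeriveDef; first exact/derivable1_diffP.
    by rewrite deriveE// diff_val scale1r.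
  by have := @is_deriveD _ _ _ (cst x) _ s 1 0 _ (is_derive_cst _ _ _) Hl; rewrite add0r.
have dhg (s : R) : 0 <= s <= 1 -> is_derive s (1 : R) (h \o g) ('d h (g s) (y - x)).
  by move=> s01; apply: is_derive_comp_diff => //; exact: dh.
have [] := @MVT_segment R (h \o g) (fun s => 'd h (g s) (y - x)) 0 1 ler01.
- by move=> s; rewrite in_itv/= => /andP[s0 s1]; apply: dhg; rewrite !ltW.
- apply: derivable_within_continuous => s; rewrite in_itv/= => s01.
  by have [] := dhg s s01.
- move=> s; rewrite in_itv/= => s01; rewrite /g /= scale0r scale1r addr0 subr0 mulr1.
  by rewrite (addrC x (y - x)) subrK => ->; exists s.
Qed.

Lemma curve_mean_value n (u du : R -> 'rV[R]_n) (a b B : R) :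
  a <= b -> (forall s : R, a <= s <= b -> is_derive s 1 u (du s)) ->
  (forall s : R, a <= s <= b -> `|du s| <= B) ->
  `|u b - u a| <= B * (b - a).
Proof.
move=> ab du_ duB.
have B0 : 0 <= B by apply: le_trans (duB a _); rewrite // lexx ab.
apply: le_row_norm; first by rewrite mulr_ge0// subr_ge0.
move=> j; have duj (s : R) : a <= s <= b -> is_derive s 1 (fun s => u s 0 j) (du s 0 j).
  move=> /du_[/derivable_mxP du1 du2]; apply: DeriveDef => //.
  by rewrite -du2 derive_mx ?mxE//; apply/derivable_mxP.
have [] := @MVT_segment R (fun s => u s 0 j) (fun s => du s 0 j) a b ab.
- by move=> s; rewrite in_itv/= => /andP[s0 s1]; apply: duj; rewrite !ltW.
- apply: derivable_within_continuous => s; rewrite in_itv/= => s01.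
  by have [] := duj s s01.
- move=> c; rewrite in_itv/= !mxE => cab ->.
  rewrite normrM (ger0_norm (_ : 0 <= b - a)) ?subr_ge0// ler_wpM2r ?subr_ge0//.
  by apply: le_trans (coord_le_norm _ _) _; apply: duB.
Qed.

End Calculus.

Section ContinuouslyDifferentiable.
Context {R : realType}.

(** A finite family of vectors with coordinates bounded by the norm. It makes the
    continuity of the derivative in each direction, which is what [Ck 1] gives,
    uniform on the unit ball. *)
Definition has_frame (V : normedModType R) :=
  exists (k : nat) (e : 'I_k -> V) (c : 'I_k -> V -> R),
    forall w, w = \sum_i c i w *: e i /\ forall i, `|c i w| <= `|w|.

Lemma frame_real : has_frame R.
Proof.
exists 1%N, (fun=> 1), (fun=> id) => w; split=> //.
by rewrite big_ord1 /GRing.scale/= mulr1.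
Qed.

Lemma frame_row n : has_frame 'rV[R]_n.
Proof.
exists n, (delta_mx 0), (fun j (w : 'rV[R]_n) => w 0 j) => w; split; last exact: coord_le_norm.
exact: row_sum_delta.
Qed.

Lemma frame_prod (V W : normedModType R) :
  has_frame V -> has_frame W -> has_frame (V * W)%type.
Proof.
move=> [k [e [c ec]]] [l [e' [c' ec']]].
exists (k + l)%N, (fun i : 'I_(k + l) => match fintype.split i with inl a => (e a, 0) | inr b => (0, e' b) end),
  (fun (i : 'I_(k + l)) (w : V * W) => match fintype.split i with inl a => c a w.1 | inr b => c' b w.2 end) => w; split.
  have pairD (a a' : V) (b b' : W) : (a, b) + (a', b') = (a + a', b + b') by [].
  rewrite big_split_ord/= [LHS]surjective_pairing.
  under eq_bigr do rewrite (unsplitK (inl _)).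
  under [in X in _ = _ + X]eq_bigr do rewrite (unsplitK (inr _)).
  have -> : \sum_(i < k) c i w.1 *: (e i, 0 : W) = (w.1, 0).
    rewrite [in RHS](proj1 (ec w.1)).
    elim/big_ind2: _ => //= [x1 x2 y1 y2 -> ->|i _]; last by congr pair; rewrite /= scaler0.
    by rewrite pairD addr0.
  have -> : \sum_(i < l) c' i w.2 *: (0 : V, e' i) = (0, w.2).
    rewrite [in RHS](proj1 (ec' w.2)).
    elim/big_ind2: _ => //= [x1 x2 y1 y2 -> ->|i _]; last by congr pair; rewrite /= scaler0.
    by rewrite pairD addr0.
  by rewrite pairD addr0 add0r.
move=> i; case: fintype.split => a; rewrite prod_normE le_max.
  by rewrite (proj2 (ec w.1)).
by rewrite (proj2 (ec' w.2)) orbT.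
Qed.

(** By the mean value theorem on the segment from [z] to [y], the second estimate
    follows from the first one, which is checked on a frame. *)
Lemma C1_strictly_differentiable (V : normedModType R) (U : set V) (h : V -> R)
    (x : V) (eta : R) :
  has_frame V -> open U -> U x -> Ck 1 U h -> 0 < eta ->
  exists2 r, 0 < r & [/\ forall y, `|y - x| < r -> U y,
    forall y, `|y - x| < r -> forall w, `|'d h y w - 'd h x w| <= eta * `|w| &
    forall y z, `|y - x| < r -> `|z - x| < r ->
      `|h y - h z - 'd h x (y - z)| <= eta * `|y - z|].
Proof.
move=> [k [e [c ec]]] oU Ux [dh cdh] eta0.
have k0 : 0 < k.+1%:R :> R by rewrite ltr0n.
have : \forall y \near x, U y /\ forall i, `|'D_(e i) h y - 'D_(e i) h x| <= eta / k.+1%:R.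
  apply: filterI; first exact: open_nbhs_nbhs.
  apply: filter_forall => i; have := cdh (e i) x Ux => /cvgrPdist_le/(_ _ (divr_gt0 eta0 k0)).
  by apply: filterS => y; rewrite distrC.
move=> /nbhs_normP[r /= r0 rP]; exists r => //.
have rU y : `|y - x| < r -> U y.
  by move=> yx; have [|//] := rP y; rewrite /= distrC.
have rd y : `|y - x| < r -> forall w, `|'d h y w - 'd h x w| <= eta * `|w|.
  move=> yx w; have [|Uy dy] := rP y; first by rewrite /= distrC.
  have dE z : 'd h z w = \sum_i c i w *: 'd h z (e i) :> R.
    by rewrite [in LHS](proj1 (ec w)) linear_sum; apply: eq_bigr => i _; rewrite linearZ.
  rewrite !dE -sumrB.
  apply: le_trans (ler_norm_sum _ _ _) _.
  apply: (@le_trans _ _ (\sum_(i < k) `|w| * (eta / k.+1%:R))).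
    apply: ler_sum => i _; rewrite -scalerBr normrZ.
    apply: ler_pM => //; first exact: (proj2 (ec w)).
    by rewrite -!deriveE//; exact: dh.
  rewrite sumr_const card_ord -mulrnAr [leRHS]mulrC ler_wpM2l// -mulr_natr -mulrA.
  by rewrite ler_piMr ?(ltW eta0)// mulrC ler_pdivrMr// mul1r ler_nat.
split=> // y z yx zx.
have seg (s : R) : 0 <= s <= 1 -> `|z + s *: (y - z) - x| < r.
  move=> /andP[s0 s1].
  have -> : z + s *: (y - z) - x = (1 - s) *: (z - x) + s *: (y - x).
    rewrite scalerBl scale1r -[RHS]addrA [in RHS](addrC (- _)) -scalerBr.
    have -> : y - x - (z - x) = y - z by rewrite opprB addrA subrK.
    by rewrite addrAC.
  apply: le_lt_trans (ler_normD _ _) _.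
  rewrite !normrZ (ger0_norm s0) (ger0_norm (_ : 0 <= 1 - s)) ?subr_ge0//.
  have m1 : `|z - x| <= Num.max `|z - x| `|y - x| by rewrite le_max lexx.
  have m2 : `|y - x| <= Num.max `|z - x| `|y - x| by rewrite le_max lexx orbT.
  apply: (@le_lt_trans _ _ (Num.max `|z - x| `|y - x|)); last by rewrite gt_max zx.
  set m := Num.max _ _ in m1 m2 *.
  by have : (1 - s) * `|z - x| <= (1 - s) * m; [rewrite ler_wpM2l// subr_ge0|
    have : s * `|y - x| <= s * m by [rewrite ler_wpM2l|lra]]; lra.
have [s s01 ->] := @segment_mean_value R V h z y (fun s s01 => dh _ (rU _ (seg s s01))).
exact: rd (seg s s01) _.
Qed.

Lemma C1_locally_lipschitz_real (V : normedModType R) (U : set V) (h : V -> R) (x : V) :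
  has_frame V -> open U -> U x -> Ck 1 U h ->
  exists r K, [/\ 0 < r, 0 <= K, forall y, `|y - x| < r -> U y &
    forall y z, `|y - x| < r -> `|z - x| < r -> `|h y - h z| <= K * `|y - z|].
Proof.
move=> fV oU Ux C1h; have [r r0 [rU _ rh]] := C1_strictly_differentiable fV oU Ux C1h ltr01.
have [k k0 kh] := linear_lipschitz (diff_continuous (proj1 C1h x Ux)).
exists r, (1 + k); split=> //; first by rewrite addr_ge0// ltW.
move=> y z yx zx; rewrite -[h y - h z](subrK ('d h x (y - z))) mulrDl.
by apply: le_trans (ler_normD _ _) _; apply: lerD; [exact: rh|exact: kh].
Qed.

Lemma Ck1_coord (V : normedModType R) n (U : set V) (f : V -> 'rV[R]_n) j :
  open U -> Ck 1 U f -> Ck 1 U (fun y => f y 0 j).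
Proof.
move=> oU [df cf]; split.
  move=> y Uy; apply: (@differentiable_comp _ _ _ _ f (fun v : 'rV_n => v 0 j : R)).
    exact: df.
  exact: differentiable_coord.
move=> v y Uy; have := cf v y Uy => cv.
have : {for y, continuous (fun z => 'D_v f z 0 j)}.
  apply: (@continuous_comp _ _ _ ('D_v f) (fun v : 'rV_n => v 0 j : R)) => //.
  exact: coord_continuous.
have dE z : U z -> 'D_v f z 0 j = 'D_v (fun y => f y 0 j) z.
  move=> Uz; have dfz : derivable f z v by apply: diff_derivable; exact: df.
  by rewrite (derive_mx dfz) mxE.
rewrite /prop_for /continuous_at dE//; apply: cvg_trans; apply: near_eq_cvg.
by have := open_nbhs_nbhs (conj oU Uy); apply: filterS => z /dE.
Qed.

Lemma C1_locally_lipschitz (V : normedModType R) n (U : set V) (f : V -> 'rV[R]_n) (x : V) :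
  has_frame V -> open U -> U x -> Ck 1 U f ->
  exists r K, [/\ 0 < r, 0 <= K, forall y, `|y - x| < r -> U y &
    forall y z, `|y - x| < r -> `|z - x| < r -> `|f y - f z| <= K * `|y - z|].
Proof.
move=> fV oU Ux C1f.
have /choice[g gP] j : exists rK : R * R, [/\ 0 < rK.1, 0 <= rK.2,
    forall y, `|y - x| < rK.1 -> U y & forall y z, `|y - x| < rK.1 ->
    `|z - x| < rK.1 -> `|f y 0 j - f z 0 j| <= rK.2 * `|y - z|].
  have [r [K H]] := C1_locally_lipschitz_real fV oU Ux (Ck1_coord j oU C1f).
  by exists (r, K).
have [r0 r00 rU] : exists2 r, 0 < r & forall y, `|y - x| < r -> U y.
  have /nbhs_normP[r /= r0 rP] := open_nbhs_nbhs (conj oU Ux).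
  by exists r => // y yx; apply: rP; rewrite /= distrC.
exists (\big[Num.min/r0]_j (g j).1), (\sum_j (g j).2); split.
- by elim/big_ind: _ => // [a b a0 b0|j _]; [rewrite lt_min a0|have [] := gP j].
- by apply: sumr_ge0 => j _; have [] := gP j.
- move=> y yx; apply: rU; apply: lt_le_trans yx _.
  by elim/big_rec: _ => // j a _ ar; rewrite ge_min ar orbT.
- move=> y z yx zx; apply: le_row_norm.
    by rewrite mulr_ge0//; apply: sumr_ge0 => j _; have [] := gP j.
  move=> j; rewrite !mxE; have [_ _ _ gj] := gP j.
  have mj : \big[Num.min/r0]_j (g j).1 <= (g j).1.
    by rewrite (bigD1 j)//= ge_min lexx.
  apply: le_trans (gj _ _ (lt_le_trans yx mj) (lt_le_trans zx mj)) _.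
  rewrite ler_wpM2r// (bigD1 j)//= lerDl.
  by apply: sumr_ge0 => i _; have [] := gP i.
Qed.

End ContinuouslyDifferentiable.

(** * Charts *)

Section Charts.
Context {R : realType} {n : nat} {M : manifold R n}.
Implicit Types (c d x : M).

Lemma dom_inv c y : (coord c @` dom c) y -> dom c (inv c y).
Proof. by move=> [x cx <-]; rewrite coordK. Qed.

Lemma coord_inv c y : (coord c @` dom c) y -> coord c (inv c y) = y.
Proof. by move=> [x cx <-]; rewrite coordK. Qed.

Lemma near_dom c x : dom c x -> \forall y \near x, dom c y.
Proof. by move=> cx; apply: open_nbhs_nbhs; split=> //; exact: open_dom. Qed.

Lemma near_image c x : dom c x -> \forall y \near coord c x, (coord c @` dom c) y.
Proof. by move=> cx; apply: open_nbhs_nbhs; split; [exact: open_coord|exists x]. Qed.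

Lemma near_inv c x (A : set M) : dom c x -> nbhs x A ->
  \forall y \near coord c x, (coord c @` dom c) y /\ A (inv c y).
Proof.
move=> cx xA; apply: filterI; first exact: near_image.
have /(@continuous_inv _ _ M)/= : (coord c @` dom c) (coord c x) by exists x.
by rewrite /prop_for /continuous_at coordK//; exact.
Qed.

Lemma chart_nbhs c x (A : set M) : dom c x -> nbhs x A ->
  exists2 r, 0 < r & forall y, `|y - coord c x| < r ->
    (coord c @` dom c) y /\ A (inv c y).
Proof.
move=> cx xA; have /nbhs_normP[r /= r0 rP] := near_inv cx xA.
by exists r => // y yr; apply: rP; rewrite /= distrC.
Qed.

Lemma near_coord c x (r : R) : dom c x -> 0 < r ->
  \forall y \near x, dom c y /\ `|coord c y - coord c x| < r.
Proof.
move=> cx r0; apply: filterI; first exact: near_dom.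
have := @continuous_coord _ _ M c x cx => /cvgrPdist_lt/(_ _ r0).
by apply: filterS => y; rewrite distrC.
Qed.

Lemma open_overlap c d : open (coord c @` (dom c `&` dom d)).
Proof.
rewrite openE => _ [x [cx dx] <-]; rewrite /interior.
apply: filterS (near_inv cx (near_dom dx)) => _ [[y cy <-]].
by rewrite coordK// => dy; exists y.
Qed.

Lemma transition_differentiable c d x : dom c x -> dom d x ->
  differentiable (coord d \o inv c) (coord c x).
Proof.
by move=> cx dx; have [+ _] := smooth_transition c d 1%N; apply; exists x.
Qed.

(** The chain rule applied to the identity, which is the composite of the two
    transition maps near [coord c x]. *)
Lemma transitionK c d x (v : 'rV[R]_n) : dom c x -> dom d x ->
  'd (coord c \o inv d) (coord d x) ('d (coord d \o inv c) (coord c x) v) = v.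
Proof.
move=> cx dx.
have d1 := transition_differentiable cx dx.
have d2 : differentiable (coord c \o inv d) ((coord d \o inv c) (coord c x)).
  by rewrite /= coordK//; exact: transition_differentiable.
have -> : coord d x = (coord d \o inv c) (coord c x) by rewrite /= coordK.
rewrite -[LHS]/(('d (coord c \o inv d) ((coord d \o inv c) (coord c x)) \o
  'd (coord d \o inv c) (coord c x)) v) -diff_comp// -deriveE; last exact: differentiable_comp.
rewrite -[RHS](@derive_id _ _ (coord c x)); apply: near_eq_derive.
apply: filterS (near_inv cx (near_dom dx)) => y [cy dy].
by rewrite /= coordK// coord_inv.
Qed.

Lemma from_chartK c x v : dom c x -> from_chart c x (to_chart c x v) = v.
Proof. by move=> cx; apply: transitionK => //; exact: mem_dom. Qed.

Lemma to_chart_id x v : to_chart x x v = v.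
Proof.
rewrite /to_chart -[X in X = _]deriveE; last by apply: transition_differentiable; exact: mem_dom.
rewrite -[RHS](@derive_id _ _ (coord x x)); apply: near_eq_derive.
by apply: filterS (near_image (mem_dom x)) => y xy /=; rewrite coord_inv.
Qed.

Lemma is_derive_change_chart c d (gamma : R -> M) (s : R) v :
  {for s, continuous gamma} -> dom c (gamma s) -> dom d (gamma s) ->
  is_derive s 1 (coord d \o gamma) v ->
  is_derive s 1 (coord c \o gamma) ('d (coord c \o inv d) (coord d (gamma s)) v).
Proof.
move=> cg cs ds dg.
have := @is_derive_comp_diff R _ _ (coord c \o inv d) (coord d \o gamma) s v _ dg.
move=> /(_ (transition_differentiable ds cs)).
apply: (@near_eq_is_derive _ _ _ _ (coord c \o gamma)).
have Hn : \forall t \near s, dom d (gamma t) := cg _ (near_dom ds).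
by apply: filterS Hn => t /= dt; rewrite coordK.
Qed.

(** The displacement from [x] to [y] is, to first order, a tangent vector at [x]
    that does not depend on the chart in which it is measured. *)
Lemma near_change_chart c d x (e : R) : dom c x -> dom d x -> 0 < e ->
  \forall y \near x, dom c y /\ dom d y /\
    `|coord d y - coord d x
      - 'd (coord d \o inv c) (coord c x) (coord c y - coord c x)|
    <= e * `|coord c y - coord c x|.
Proof.
move=> cx dx e0.
have Hd : \forall y \near x, `|(coord d \o inv c) (coord c y) - (coord d \o inv c) (coord c x)
    - 'd (coord d \o inv c) (coord c x) (coord c y - coord c x)|
    <= e * `|coord c y - coord c x| :=
  continuous_coord cx (differentiable_eps (transition_differentiable cx dx) e0).
apply: filterS (filterI Hd (filterI (near_dom cx) (near_dom dx))) => y [+ [cy dy]].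
by rewrite /= !coordK.
Qed.

Lemma near_change_chart_lipschitz c d x : dom c x -> dom d x ->
  exists2 K, 0 <= K & \forall y \near x, dom c y /\ dom d y /\
    `|coord d y - coord d x| <= K * `|coord c y - coord c x|.
Proof.
move=> cx dx.
have [k k0 kT] := linear_lipschitz (diff_continuous (transition_differentiable cx dx)).
exists (1 + k); first by rewrite addr_ge0// ltW.
apply: filterS (near_change_chart cx dx ltr01) => y [cy [dy H]]; do 2 split=> //.
rewrite -[_ - _](subrK ('d (coord d \o inv c) (coord c x) (coord c y - coord c x))) mulrDl.
by apply: le_trans (ler_normD _ _) _; apply: lerD.
Qed.

(** A curve cannot leave the ball of radius [r] of the chart if, as long as it has
    stayed there, it is in fact in the smaller ball of radius [rho]. The image of
    the closed smaller ball is compact, hence closed in [M], so that the curve is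
    still in it at the end of any half-open interval spent in it. *)
Lemma trapped_in_chart c (y0 : 'rV[R]_n) (r rho : R) (gamma : R -> M) (a b : R) :
  a <= b -> rho < r ->
  (forall y, `|y - y0| < r -> (coord c @` dom c) y) ->
  (forall s, a <= s <= b -> forall A, nbhs (gamma s) A ->
     exists2 e, 0 < e & forall s', a <= s' <= b -> `|s' - s| < e -> A (gamma s')) ->
  dom c (gamma a) -> `|coord c (gamma a) - y0| < r ->
  (forall s, a <= s <= b ->
     (forall s', a <= s' <= s -> dom c (gamma s') /\ `|coord c (gamma s') - y0| < r) ->
     `|coord c (gamma s) - y0| <= rho) ->
  forall s, a <= s <= b -> dom c (gamma s) /\ `|coord c (gamma s) - y0| < r.
Proof.
move=> ab rhor rim cg ca ra bound.
pose P s := forall s', a <= s' <= s -> dom c (gamma s') /\ `|coord c (gamma s') - y0| < r.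
suff H : forall s, a <= s <= b -> P s.
  by move=> s sab; apply: (H s sab); have /andP[as_ _] := sab; rewrite as_ lexx.
apply: real_induction => //.
- by move=> s' /le_anti <-.
- move=> s /andP[as_ sb] Ps.
  have [cs rs] : dom c (gamma s) /\ `|coord c (gamma s) - y0| < r by apply: Ps; rewrite as_ lexx.
  have r1 : 0 < r - `|coord c (gamma s) - y0| by rewrite subr_gt0.
  have [|e e0 eP] := cg s _ _ (near_coord cs r1); first by rewrite as_ ltW.
  exists e => // t /andP[st te] tb s' /andP[as' s't].
  have [s's|ss'] := leP s' s; first by apply: Ps; rewrite as'.
  have [||cs' rs'] := eP s'.
  - by rewrite as'/= (le_trans s't).
  - by rewrite gtr0_norm ?subr_gt0// ltrBlDl (le_lt_trans s't).
  split=> //; rewrite -(subrK (coord c (gamma s)) (coord c (gamma s'))) -addrA.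
  by apply: le_lt_trans (ler_normD _ _) _; rewrite -ltrBrDr.
- move=> s /andP[as_ sb] Hs.
  pose K := inv c @` [set y | `|y - y0| <= rho].
  have cK : compact K.
    apply: continuous_compact.
      apply: continuous_in_subspaceT => y; rewrite inE /= => yr.
      by apply: continuous_inv; apply: rim; exact: le_lt_trans yr rhor.
    have -> : [set y | `|y - y0| <= rho] = closed_ball_ (fun v : 'rV[R]_n => `|v|) y0 rho.
      by apply/seteqP; split=> y; rewrite /closed_ball_/= (distrC y).
    apply: bounded_closed_compact; last exact: closed_closed_ball_.
    exists (`|y0| + rho); split; first exact: num_real.
    move=> m m1 y; rewrite /closed_ball_/= distrC => yr; apply: le_trans (ltW m1).
    by rewrite -(subrK y0 y) addrC (le_trans (ler_normD _ _))// lerD2l.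
  have clK : closed K by apply: compact_closed => //; exact: carrier_hausdorff.
  have Ks' s' : a <= s' < s -> K (gamma s').
    move=> /andP[as' s's]; have Ps' : P s' by apply: Hs; rewrite as'.
    have [|cs' _] := Ps' s'; first by rewrite as' lexx.
    exists (coord c (gamma s')); last by rewrite coordK.
    by apply: bound => //; rewrite as' (le_trans (ltW s's)).
  have Ks : K (gamma s).
    apply: clK => A /(cg s _)[|e e0 eA]; first by rewrite ltW.
    pose s' := Num.max a (s - e / 2).
    have as' : a <= s' by rewrite le_max lexx.
    have s's : s' < s by rewrite gt_max as_/=; lra.
    exists (gamma s'); split; first by apply: Ks'; rewrite as'.
    apply: eA; first by rewrite as'/= (le_trans (ltW s's)).
    rewrite distrC gtr0_norm ?subr_gt0// ltrBlDl -ltrBlDr lt_max.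
    by apply/orP; right; lra.
  have [cs rs] : dom c (gamma s) /\ `|coord c (gamma s) - y0| < r.
    have [y /= yr ygs] := Ks; have imy := rim y (le_lt_trans yr rhor).
    by rewrite -ygs coord_inv//; split; [exact: dom_inv|exact: le_lt_trans yr rhor].
  move=> s' /andP[as']; rewrite le_eqVlt => /orP[/eqP->//|s's].
  by apply: (Hs s'); rewrite as' ?lexx.
Qed.

End Charts.

(** * Riemannian distance and charts *)

Section RiemannianDistance.
Context {R : realType} {n : nat} {M : manifold R n}.

Lemma within_segment_nbhs (T : topologicalType) (gamma : R -> T) (a b s : R) (A : set T) :
  {within `[a, b], continuous gamma} -> a <= s <= b -> nbhs (gamma s) A ->
  exists2 e, 0 < e & forall s', a <= s' <= b -> `|s' - s| < e -> A (gamma s').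
Proof.
move=> /subspace_continuousP cg sab gA.
have sab' : `[a, b]%classic s by rewrite /= in_itv.
have := cg s sab' A gA; rewrite /= nbhs_simpl => /nbhs_normP[e /= e0 eP].
exists e => // s' s'ab s'e; apply: eP; first by rewrite /= distrC.
by rewrite /= in_itv.
Qed.

Lemma bilin_sum (G : 'M[R]_n) (I : finType) (w : I -> R) (u : I -> 'rV[R]_n) :
  bilin G (\sum_i w i *: u i) (\sum_i w i *: u i)
  = \sum_i \sum_j w i * w j * bilin G (u i) (u j).
Proof.
rewrite /bilin !mulmx_suml summxE; apply: eq_bigr => i _.
rewrite linear_sum mulmx_sumr summxE; apply: eq_bigr => j _.
by rewrite linearZ/= -scalemxAr -!scalemxAl !mxE mulrCA mulrA.
Qed.

(** The metric in coordinates is positive on the compact unit sphere at the centre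
    of the chart; compactness gives a common lower bound there and at
    all nearby points. *)
Lemma riemannian_metric_lower_bound (g : M -> 'M[R]_n) (x : M) :
  riemannian_metric g ->
  exists r k, [/\ 0 < r, 0 < k, forall y, `|y - coord x x| < r -> (coord x @` dom x) y &
    forall y w, `|y - coord x x| < r ->
      (k * `|w|) ^+ 2 <= bilin (g (inv x y)) (from_chart x (inv x y) w) (from_chart x (inv x y) w)].
Proof.
move=> [_ gpos gsm].
pose G i j (y : 'rV[R]_n) := bilin (g (inv x y)) (from_chart x (inv x y) (delta_mx 0 i))
  (from_chart x (inv x y) (delta_mx 0 j)).
pose Q (y w : 'rV[R]_n) := \sum_i \sum_j w 0 i * w 0 j * G i j y.
have QE y w : bilin (g (inv x y)) (from_chart x (inv x y) w) (from_chart x (inv x y) w) = Q y w.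
  rewrite {1 2}(row_sum_delta w) /from_chart !linear_sum.
  have dZ i : 'd (coord (inv x y) \o inv x) (coord x (inv x y)) (w 0 i *: delta_mx 0 i) =
    w 0 i *: from_chart x (inv x y) (delta_mx 0 i) by rewrite linearZ.
  by rewrite (eq_bigr _ (fun i _ => dZ i)) bilin_sum.
have y0 : (coord x @` dom x) (coord x x) by exists x => //; exact: mem_dom.
have cG i j : {for coord x x, continuous (G i j)}.
  by have := gsm x (delta_mx 0 i) (delta_mx 0 j) 0%N; exact.
have Sc : compact [set w : 'rV[R]_n | `|w| = 1].
  apply: bounded_closed_compact.
    by exists 1; split => // m m1 w /= ->; exact: ltW.
  apply: (@closed_comp _ _ (fun w : 'rV[R]_n => `|w|) [set 1]); last exact: closed_eq.
  by move=> w _; exact: norm_continuous.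
have Hn : \forall yc \near (nbhs (coord x x, 0 : R)), [set w : 'rV[R]_n | `|w| = 1] `<=` (fun w => yc.2 < Q yc.1 w).
  apply: (proj1 (compact_near_coveringP _) Sc _ (nbhs (coord x x, 0 : R)) (fun yc w => yc.2 < Q yc.1 w) _).
  move=> w /= w1.
  have Qw : 0 < Q (coord x x) w.
    rewrite -QE coordK; last exact: mem_dom.
    apply: gpos; rewrite -[from_chart _ _ _]/(to_chart x x w) to_chart_id.
    by rewrite -normr_gt0 w1.
  pose Psi (z : 'rV[R]_n * ('rV[R]_n * R)) := Q z.2.1 z.1 - z.2.2.
  have cPsi : Psi z @[z --> (w, (coord x x, 0 : R))] --> Q (coord x x) w - 0.
    have c1 : z.1 @[z --> (w, (coord x x, 0 : R))] --> w by exact: cvg_fst.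
    have c2 : z.2 @[z --> (w, (coord x x, 0 : R))] --> (coord x x, 0 : R) by exact: cvg_snd.
    have c21 : z.2.1 @[z --> (w, (coord x x, 0 : R))] --> coord x x.
      by apply: (cvg_comp _ _ c2); exact: cvg_fst.
    have c1i i : (fun z : 'rV[R]_n * ('rV[R]_n * R) => z.1 0 i) @ (w, (coord x x, 0 : R)) --> w 0 i.
      exact: (@cvg_comp _ _ _ (fun z : 'rV[R]_n * ('rV[R]_n * R) => z.1)
        (fun v : 'rV_n => v 0 i) _ _ _ c1 (@coord_continuous _ _ _ 0 i w)).
    apply: cvgB; last by apply: (cvg_comp _ _ c2); exact: cvg_snd.
    apply: cvg_big => [|i _]; first exact: add_continuous.
    apply: cvg_big => [|j _]; first exact: add_continuous.
    apply: cvgM; last by apply: (cvg_comp _ _ c21); exact: cG.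
    by apply: cvgM; exact: c1i.
  rewrite subr0 in cPsi; have H : filter_prod (nbhs w) (nbhs (coord x x, 0 : R)) [set z | 0 < Psi z] :=
    cvgr_gt _ cPsi _ Qw.
  suff : filter_prod (nbhs w) (nbhs (coord x x, 0 : R)) [set z | z.2.2 < Q z.2.1 z.1] by [].
  rewrite (_ : [set z | _] = [set z | 0 < Psi z])//.
    exact: H.
  by apply/seteqP; split=> z; rewrite /Psi /= subr_gt0.
have /nbhs_normP[e /= e0 eP] : \forall yc \near (coord x x, 0 : R), forall w : 'rV[R]_n, `|w| = 1 -> yc.2 < Q yc.1 w.
  exact: Hn.
have [r' r'0 rim] := chart_nbhs (mem_dom x) (near_dom (mem_dom x)).
exists (Num.min r' e), (Num.sqrt (e / 2)); split.
- by rewrite lt_min r'0.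
- by rewrite sqrtr_gt0 divr_gt0.
- by move=> z; rewrite lt_min => /andP[zr _]; have [] := rim z zr.
- move=> z w; rewrite lt_min => /andP[zr ze]; rewrite QE.
  have Qz w' : `|w'| = 1 -> e / 2 < Q z w'.
    apply: (eP (z, e / 2)); rewrite /= prod_normE /= gt_max distrC ze/= sub0r normrN gtr0_norm ?divr_gt0//; lra.
  have [->|w0] := eqVneq w 0.
    rewrite normr0 mulr0 expr0n/= /Q big1// => i _; rewrite big1// => j _.
    by rewrite !mxE !mul0r.
  have nw : 0 < `|w| by rewrite normr_gt0.
  have QZ k v : Q z (k *: v) = k ^+ 2 * Q z v.
    rewrite /Q mulr_sumr; apply: eq_bigr => i _; rewrite mulr_sumr; apply: eq_bigr => j _.
    by rewrite !mxE; ring.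
  have -> : Q z w = `|w| ^+ 2 * Q z (`|w|^-1 *: w).
    by rewrite -QZ scalerA divff ?scale1r// gt_eqF.
  rewrite exprMn sqr_sqrtr; last by rewrite divr_ge0 ?ltW.
  rewrite mulrC ler_wpM2l ?sqr_ge0// ltW// Qz//.
  by rewrite normrZ normfV normr_id mulVf ?gt_eqF.
Qed.

Lemma path_length_ge0 (g : M -> 'M[R]_n) gamma : (0 <= path_length g gamma)%E.
Proof. by apply: integral_ge0 => s _; rewrite lee_fin sqrtr_ge0. Qed.

Lemma riemannian_dist_ge0 (g : M -> 'M[R]_n) x y : (0 <= riemannian_dist g x y)%E.
Proof. by apply: le_ereal_inf_tmp => _ [gamma _ <-]; exact: path_length_ge0. Qed.

Lemma C1_path_chart_locally_lipschitz (gamma : R -> M) (x : M) (t : R) :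
  C1_path gamma -> 0 <= t <= 1 -> dom x (gamma t) ->
  exists d K, [/\ 0 < d, 0 <= K & forall s s', 0 <= s <= 1 -> 0 <= s' <= 1 ->
    `|s - t| < d -> `|s' - t| < d ->
    `|coord x (gamma s) - coord x (gamma s')| <= K * `|s - s'|].
Proof.
move=> [cg eg] t01 xt.
have [|U [h [oU Ut C1h hE]]] := eg t; first by rewrite in_itv.
have [r1 [K1 [r10 K10 r1U hK]]] := C1_locally_lipschitz frame_real oU Ut C1h.
have tt := mem_dom (gamma t).
have overlap : (coord (gamma t) @` (dom (gamma t) `&` dom x)) (coord (gamma t) (gamma t)).
  by exists (gamma t).
have [r2 [K2 [r20 K20 _ TK]]] := C1_locally_lipschitz (frame_row n)
  (@open_overlap _ _ _ (gamma t) x) overlap (smooth_transition (gamma t) x 1%N).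
have [d1 d10 d1P] := within_segment_nbhs cg t01 (near_coord tt r20).
exists (Num.min r1 d1), (K2 * K1); split; rewrite ?mulr_ge0// ?lt_min ?r10//.
move=> s s' s01 s'01; rewrite !lt_min => /andP[sr sd] /andP[s'r s'd].
have [ds rs] := d1P s s01 sd; have [ds' rs'] := d1P s' s'01 s'd.
have := TK _ _ rs rs'; rewrite /= !coordK// => /le_trans; apply.
rewrite -mulrA ler_wpM2l//; have := hK _ _ sr s'r.
by rewrite -!hE//=; try (exact: r1U); rewrite in_itv.
Qed.

Lemma C1_path_is_derive (gamma : R -> M) (s : R) :
  C1_path gamma -> 0 < s < 1 -> {for s, continuous gamma} /\
    is_derive s 1 (coord (gamma s) \o gamma) (velocity gamma s).
Proof.
move=> [cg eg] /andP[s0 s1]; have s01 : 0 <= s <= 1 by rewrite !ltW.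
have near01 : \forall t \near s, 0 <= t <= 1.
  apply: filterS (@near_in_itvoo R 0 1 s _); last by rewrite in_itv/= s0.
  by move=> t; rewrite in_itv/= => /andP[t0 t1]; rewrite !ltW.
split.
  move=> A As; have [e e0 eP] := within_segment_nbhs cg s01 As.
  have near_e : \forall t \near s, `|t - s| < e.
    exact: near_dist_lt.
  apply: filterS (filterI near01 near_e) => t [t01 te]; exact: eP.
have [|U [h [oU Us [dh _] hE]]] := eg s; first by rewrite in_itv.
have nU : \forall t \near s, U t by apply: open_nbhs_nbhs.
apply: DeriveDef => //; apply: (@near_eq_derivable _ _ _ h).
  by apply: filterS (filterI near01 nU) => t [t01 Ut]; rewrite hE//= in_itv.
by apply/diff_derivable/dh.
Qed.

(** A path from [x] of small length is trapped in the chart of [x]: as long as it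
    stays in a ball where the metric is bounded below, each coordinate varies at
    most by a multiple of the length already run. *)
Lemma riemannian_dist_chart (g : M -> 'M[R]_n) (x : M) : riemannian_metric g ->
  exists r K, [/\ 0 < r, 0 <= K & forall y l, l <= r ->
    (riemannian_dist g x y < l%:E)%E ->
    dom x y /\ `|coord x y - coord x x| <= K * l].
Proof.
move=> gm; have [r [k [r0 k0 rim glb]]] := riemannian_metric_lower_bound x gm.
exists (k * (r / 2)), k^-1; split; rewrite ?mulr_gt0 ?invr_ge0 ?divr_gt0 ?ltW//.
move=> y l lr /ereal_inf_lt[_ [gamma [C1g g0 g1] <-] lenl].
have [cg _] := C1g.
have bound s : 0 <= s <= 1 ->
   (forall s', 0 <= s' <= s -> dom x (gamma s') /\ `|coord x (gamma s') - coord x x| < r) ->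
   `|coord x (gamma s) - coord x x| <= k^-1 * l.
  move=> /andP[s0 s1] gs.
  have l0 : 0 <= l by rewrite -lee_fin; apply: le_trans (ltW lenl); exact: path_length_ge0.
  apply: le_row_norm => [|j]; first by rewrite mulr_ge0// invr_ge0 ltW.
  rewrite !mxE.
  move: s0; rewrite le_eqVlt => /orP[/eqP<-|s0].
    by rewrite g0 subrr normr0 mulr_ge0// invr_ge0 ltW.
  rewrite ler_pdivlMl// -lee_fin.
  pose F t := k * coord x (gamma t) 0 j.
  have -> : k * `|coord x (gamma s) 0 j - coord x x 0 j| = `|F s - F 0|.
    by rewrite /F g0 -mulrBr normrM gtr0_norm.
  apply: le_trans _ (ltW lenl).
  pose speed t := (Num.sqrt (bilin (g (gamma t)) (velocity gamma t) (velocity gamma t)))%:E.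
  have len_s : (\int[lebesgue_measure]_(t in `]0%R, s[) speed t <= path_length g gamma)%E.
    apply: ge0_integral_mono => // [t|t _]; rewrite ?lee_fin ?sqrtr_ge0//= !in_itv/= => /andP[t0 ts].
    by rewrite ltW// (le_trans (ltW ts)).
  apply: le_trans _ len_s; apply: increment_le_integral => //.
  - move=> t /andP[t0 ts].
    have [|xt _] := gs t; first by rewrite t0.
    have [|d [K [d0 K0 dK]]] := C1_path_chart_locally_lipschitz C1g _ xt.
      by rewrite t0 (le_trans ts).
    exists d, (k * K); split=> // a b /andP[a0 as_] /andP[b0 bs] ad bd.
    rewrite /F -mulrBr normrM gtr0_norm// -mulrA (ler_wpM2l (ltW k0))//.
    have := dK a b; rewrite a0 b0 (le_trans as_ s1) (le_trans bs s1) => /(_ isT isT ad bd).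
    move=> H.
    apply: le_trans _ H.
    by have := coord_le_norm (coord x (gamma a) - coord x (gamma b)) j; rewrite !mxE.
  - by move=> t _; rewrite lee_fin sqrtr_ge0.
  - move=> t /andP[t0 ts] e; rewrite lte_fin => spe.
    have [|xt rt] := gs t; first by rewrite !ltW.
    have [|ct dt] := C1_path_is_derive C1g (_ : 0 < t < 1).
      by rewrite t0 (lt_le_trans ts).
    have dxt := is_derive_change_chart ct xt (mem_dom _) dt.
    set w := 'd _ _ _ in dxt.
    have wE : from_chart x (gamma t) w = velocity gamma t.
      by rewrite /w -[X in from_chart _ _ X]/(to_chart x (gamma t) (velocity gamma t)) from_chartK.
    have := glb _ w rt; rewrite coordK// wE => glbw.
    have kwe : k * `|w| < e.
      apply: le_lt_trans spe; rewrite -(ger0_norm (_ : 0 <= k * `|w|)).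
        by rewrite -sqrtr_sqr ler_wsqrtr.
      by rewrite mulr_ge0// ltW.
    have e1 : 0 < (e - k * `|w|) / k by rewrite divr_gt0// subr_gt0.
    have [dd dv] := dxt; move/derivable1_diffP : (dd) => dd'.
    apply: filterS (differentiable_eps dd' e1) => u.
    have -> : 'd (coord x \o gamma) t (u - t) = (u - t) *: w.
      by rewrite -dv deriveE// -linearZ /GRing.scale/= mulr1.
    move=> /= Hu; rewrite /F -mulrBr normrM gtr0_norm//.
    rewrite -ler_pdivlMl//.
    have -> : coord x (gamma u) 0 j - coord x (gamma t) 0 j =
      (coord x (gamma u) - coord x (gamma t) - (u - t) *: w) 0 j + (u - t) * w 0 j.
      by rewrite !mxE; ring.
    apply: le_trans (ler_normD _ _) _.
    apply: le_trans (lerD (le_trans (coord_le_norm _ _) Hu) (_ : _ <= `|u - t| * `|w|)) _.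
      by rewrite normrM ler_wpM2l// coord_le_norm.
    rewrite le_eqVlt; apply/orP; left; apply/eqP; field.
    by rewrite gt_eqF.
have trapped : forall s, 0 <= s <= 1 -> dom x (gamma s) /\ `|coord x (gamma s) - coord x x| < r.
  apply: (@trapped_in_chart _ _ _ _ _ _ (k^-1 * l)) => //.
  - apply: le_lt_trans (_ : k^-1 * l <= r / 2) _; last by lra.
    by rewrite ler_pdivrMl.
  - by move=> s s01 A; exact: within_segment_nbhs.
  - by rewrite g0; exact: mem_dom.
  - by rewrite g0 subrr normr0.
have h1 : is_true ((0 : R) <= (1 : R) <= (1 : R)) by rewrite ler01 lexx.
have [t1 _] := trapped 1 h1.
by rewrite -g1; split; [exact: t1|apply: bound].
Qed.

End RiemannianDistance.

(** * Dependence of closed orbits on their initial data *)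

Section OrbitDependence.
Context {R : realType} {n : nat} {M : manifold R n}.
Variable X : R -> M -> 'rV[R]_n.
Hypothesis smX : smooth_family X.

Definition chart_field (c : M) (y : 'rV[R]_n) (t : R) : 'rV[R]_n :=
  to_chart c (inv c y) (X t (inv c y)).

Lemma chart_field_locally_lipschitz c x (t : R) : dom c x -> 0 <= t <= 1 ->
  exists r L V, [/\ 0 < r, 0 <= L, 0 <= V,
    forall y, `|y - coord c x| < r -> (coord c @` dom c) y &
    forall y t', `|y - coord c x| < r -> `|t' - t| < r -> 0 <= t' <= 1 ->
      `|chart_field c y t'| <= V /\
      forall y' t'', `|y' - coord c x| < r -> `|t'' - t| < r -> 0 <= t'' <= 1 ->
        `|chart_field c y t' - chart_field c y' t''| <= L * (`|y - y'| + `|t' - t''|)].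
Proof.
move=> cx t01; have [|U [h [oU Ut smh hE]]] := smX (c := c) (x := (coord c x, t)).
  by split => /=; [exists x|rewrite in_itv].
have [r1 [L [r10 L0 r1U hL]]] := C1_locally_lipschitz
  (frame_prod (frame_row n) frame_real) oU Ut (smh 1%N).
have [r2 r20 r2P] := chart_nbhs cx (near_dom cx).
pose r := Num.min r1 r2.
have inr (y : 'rV[R]_n) (t' : R) : `|y - coord c x| < r -> `|t' - t| < r ->
    `|((y, t') : 'rV[R]_n * R) - (coord c x, t)| < r1.
  by rewrite !lt_min => /andP[? _] /andP[? _]; rewrite prod_normE /= gt_max; apply/andP.
have FE (y : 'rV[R]_n) (t' : R) : `|y - coord c x| < r -> `|t' - t| < r -> 0 <= t' <= 1 ->
    chart_field c y t' = h (y, t').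
  move=> yr t'r t'01; rewrite -hE//=; first exact/r1U/inr.
  split => /=; last by rewrite in_itv.
  by move: yr; rewrite lt_min => /andP[_ /r2P[]].
have r0 : 0 < r by rewrite lt_min r10.
exists r, L, (`|h (coord c x, t)| + L * r1); split=> //.
- by rewrite addr_ge0// mulr_ge0// ltW.
- by move=> y; rewrite lt_min => /andP[_ /r2P[]].
move=> y t' yr t'r t'01; rewrite FE//; split.
  rewrite -[h (y, t')](subrK (h (coord c x, t))) addrC.
  apply: le_trans (ler_normD _ _) _; rewrite lerD2l.
  apply: le_trans (hL _ _ (inr _ _ yr t'r) _) _; first by rewrite subrr normr0.
  by rewrite ler_wpM2l// ltW// inr.
move=> y' t'' y'r t''r t''01; rewrite FE//.
apply: le_trans (hL _ _ (inr _ _ yr t'r) (inr _ _ y'r t''r)) _.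
by rewrite ler_wpM2l// prod_normE /= ge_max lerDl lerDr !normr_ge0.
Qed.

Lemma orbit_is_derive (o : loop M) (p t : R) (c : M) (s : R) :
  orbit_space X (o, p, t) -> dom c (o s) ->
  is_derive s (1 : R) (coord c \o o) (p *: chart_field c (coord c (o s)) t).
Proof.
move=> [_ _ _ do_] cs.
have := is_derive_change_chart (@loop_continuous _ _ _ o s) cs (mem_dom (o s)) (do_ s).
by rewrite linearZ /chart_field coordK.
Qed.

Section Family.
Context {I : Type} (F : set_system I) {FF : Filter F} (eps : I -> R).
Hypothesis eps0 : forall i, 0 <= eps i.
Hypothesis eps_cvg : eps @ F --> (0 : R).

Lemma near_eps (K e : R) : 0 < e -> \forall i \near F, K * eps i < e.
Proof.
move=> e0; have : K * eps i @[i --> F] --> K * 0 by apply: cvgM => //; exact: cvg_cst.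
by rewrite mulr0 => /cvgr_lt; exact.
Qed.

(** By [close_in_change_chart], this does not depend on the chart [c] around [x],
    up to the constant [K]. *)
Definition close_in (c x : M) (xs : I -> M) := exists2 K, 0 <= K &
  \forall i \near F, dom c (xs i) /\ `|coord c (xs i) - coord c x| <= K * eps i.

Lemma close_in_cvg (c x : M) (xs : I -> M) (A : set M) :
  dom c x -> close_in c x xs -> nbhs x A -> \forall i \near F, A (xs i).
Proof.
move=> cx [K K0 close] xA; have [r r0 rA] := chart_nbhs cx xA.
apply: filterS (filterI close (near_eps K r0)) => i [[ci ri] er].
by have [_] := rA _ (le_lt_trans ri er); rewrite coordK.
Qed.

Lemma close_in_change_chart (c d x : M) (xs : I -> M) :
  dom c x -> dom d x -> close_in c x xs -> close_in d x xs.
Proof.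
move=> cx dx close; have [K' K'0 K'P] := near_change_chart_lipschitz cx dx.
have [K K0 closeK] := close.
exists (K' * K); first by rewrite mulr_ge0.
apply: filterS (filterI closeK (close_in_cvg cx close K'P)) => i [[_ ri] [_ [di]]].
by move=> H; split=> //; apply: le_trans H _; rewrite -mulrA ler_wpM2l.
Qed.

Variables (o : loop M) (p t : R) (os : I -> loop M) (ps ts : I -> R).
Hypothesis orbit_o : orbit_space X (o, p, t).
Hypothesis orbit_os : \forall i \near F, orbit_space X (os i, ps i, ts i).
Hypothesis close_ps : \forall i \near F, `|ps i - p| <= eps i.
Hypothesis close_ts : \forall i \near F, `|ts i - t| <= eps i.

(** One step of continuous dependence on initial data, inside the chart of
    [o tau]. On an interval of length less than [2 * d] the curves stay in the
    chart because their speed is bounded, and the maximum [m] of the distance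
    between them satisfies m <= (initial distance) + m / 2 + O(eps), since the
    vector field is Lipschitz in space and in the parameter. *)
Lemma close_step (tau : R) : exists2 d, 0 < d &
  (forall s, `|s - tau| < d -> dom (o tau) (o s)) /\
  forall a, `|a - tau| < d -> close_in (o a) (o a) (fun i => os i a) ->
    exists2 K, 0 <= K & \forall i \near F, forall s, a <= s -> s < tau + d ->
      dom (o tau) (os i s) /\ `|coord (o tau) (os i s) - coord (o tau) (o s)| <= K * eps i.
Proof.
have [p0 t01 _ _] := orbit_o; set c := o tau.
have cc := mem_dom c.
have [r [L [V [r0 L0 V0 rim rF]]]] := chart_field_locally_lipschitz cc t01.
have r4 : 0 < r / 4 by rewrite divr_gt0.
have [d1 /= d10 d1P] : exists2 d1, 0 < d1 & forall s, `|s - tau| < d1 ->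
    dom c (o s) /\ `|coord c (o s) - coord c c| < r / 4.
  have := @loop_continuous _ _ _ o tau _ (near_coord cc r4) => /nbhs_normP[d1 /= d10 dP].
  by exists d1 => // s sd; apply: dP; rewrite /= distrC.
have p1 : 0 < p + 1 by rewrite addr_gt0.
(* The second bound keeps the curves in the ball of radius r during a time 2 d;
   the third one makes the contribution of the Lipschitz constant at most 1 / 2. *)
pose d := Num.min d1 (Num.min (r / 4 / (2 * (p + 1) * (V + 1))) (4^-1 / ((p + 1) * (L + 1)))).
have V1 : 0 < V + 1 by rewrite ltr_wpDl.
have L1 : 0 < L + 1 by rewrite ltr_wpDl.
have d0 : 0 < d by rewrite !lt_min d10 !divr_gt0 ?mulr_gt0.
have dd1 : d <= d1 by rewrite ge_min lexx.
have dV : 2 * d * ((p + 1) * V) <= r / 4.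
  have : d <= r / 4 / (2 * (p + 1) * (V + 1)) by rewrite !ge_min lexx orbT.
  rewrite ler_pdivlMr ?mulr_gt0//; apply: le_trans.
  have -> : d * (2 * (p + 1) * (V + 1)) = 2 * d * ((p + 1) * V) + 2 * d * (p + 1) by ring.
  by rewrite lerDl !mulr_ge0// ltW.
have dL : 2 * d * ((p + 1) * L) <= 2^-1.
  have : d <= 4^-1 / ((p + 1) * (L + 1)) by rewrite !ge_min lexx !orbT.
  rewrite ler_pdivlMr ?mulr_gt0// => H.
  have : 2 * (d * ((p + 1) * (L + 1))) <= 2 * 4^-1 by rewrite ler_wpM2l.
  have -> : 2 * (d * ((p + 1) * (L + 1))) = 2 * d * ((p + 1) * L) + 2 * d * (p + 1) by ring.
  have : 0 <= 2 * d * (p + 1) by rewrite !mulr_ge0// ltW.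
  lra.
exists d => //; split; first by move=> s sd; have [] := d1P s (lt_le_trans sd dd1).
move=> a ad close_a; have [ca ra] := d1P a (lt_le_trans ad dd1).
have [Ka Ka0 Kanear] := close_in_change_chart (mem_dom _) ca close_a.
pose C := 2 * d * ((p + 1) * L + V).
have C0 : 0 <= C by rewrite !mulr_ge0// ?addr_ge0 ?mulr_ge0// ltW.
exists (2 * (Ka + C)); first by rewrite mulr_ge0// addr_ge0.
near=> i => b ab bd.
have orb : orbit_space X (os i, ps i, ts i) by near: i.
have [psi0 tsi01 _ _] := orb.
have psi : `|ps i - p| <= eps i by near: i.
have tsi : `|ts i - t| <= eps i by near: i.
have [cia ria] : dom c (os i a) /\ `|coord c (os i a) - coord c (o a)| <= Ka * eps i by near: i.
have e1 : 1 * eps i < 1 by near: i; exact: near_eps.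
have er : 1 * eps i < r by near: i; exact: near_eps.
have eK : Ka * eps i < r / 4 by near: i; exact: near_eps.
rewrite mul1r in e1; rewrite mul1r in er.
have psp : ps i <= p + 1 by move: psi; rewrite ler_norml; lra.
have tir : `|ts i - t| < r by exact: le_lt_trans er.
have ad' := ad; rewrite ltr_distl in ad'; have /andP[ad1 ad2] := ad'.
have len s : a <= s -> s <= b -> s - a <= 2 * d by move=> _ sb; lra.
have start : `|coord c (os i a) - coord c c| < r / 2.
  rewrite -(subrK (coord c (o a)) (coord c (os i a))) -addrA.
  by apply: le_lt_trans (ler_normD _ _) _; lra.
have trapped s : a <= s <= b -> dom c (os i s) /\ `|coord c (os i s) - coord c c| < r.
  apply: (@trapped_in_chart _ _ _ _ _ _ (3 / 4 * r)) => //.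
  - lra.
  - move=> s' _ A As'.
    have := @loop_continuous _ _ _ (os i) s' _ As' => /nbhs_normP[e /= e0 eP].
    by exists e => // s'' _ ss; apply: eP; rewrite /= distrC.
  - by apply: lt_trans start _; lra.
  - move=> s' /andP[as' s'b] ins.
    have : `|coord c (os i s') - coord c (os i a)| <= (p + 1) * V * (s' - a).
      apply: (@curve_mean_value _ _ (coord c \o os i)
        (fun s => ps i *: chart_field c (coord c (os i s)) (ts i))) => //.
      - by move=> v vs; apply: orbit_is_derive => //; have [] := ins v vs.
      - move=> v vs; have [cv rv] := ins v vs; rewrite normrZ gtr0_norm//.
        by apply: ler_pM => //; [exact: ltW|have [] := rF _ _ rv tir tsi01].
    have : (p + 1) * V * (s' - a) <= 2 * d * ((p + 1) * V).
      by rewrite mulrC ler_wpM2r// ?mulr_ge0 ?(ltW p1)// len.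
    move=> H1 H2; rewrite -(subrK (coord c (os i a)) (coord c (os i s'))) -addrA.
    by apply: le_trans (ler_normD _ _) _; lra.
have o_in s : a <= s <= b -> dom c (o s) /\ `|coord c (o s) - coord c c| < r.
  move=> /andP[as_ sb]; have [|cs rs] := d1P s.
    rewrite ltr_distl; apply/andP; split.
      by apply: lt_le_trans as_; apply: le_lt_trans ad1; rewrite lerD2l lerN2.
    by apply: le_lt_trans sb (lt_le_trans bd _); rewrite lerD2l.
  by split=> //; apply: lt_trans rs _; rewrite ltr_pdivrMr// ltr_pMr// ltr1n.
pose u s := coord c (os i s) - coord c (o s).
have du s : a <= s <= b -> is_derive s 1 u
    (ps i *: chart_field c (coord c (os i s)) (ts i) - p *: chart_field c (coord c (o s)) t).
  move=> sab; apply: is_deriveB.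
    by apply: orbit_is_derive => //; have [] := trapped s sab.
  by apply: orbit_is_derive => //; have [] := o_in s sab.
have cu : {within `[a, b], continuous (fun s => `|u s|)}.
  apply: continuous_in_subspaceT => s; rewrite inE/= in_itv/= => sab.
  have [/derivable1_diffP/differentiable_continuous cus _] := du s sab.
  by apply: (@continuous_comp _ _ _ u (fun v : 'rV[R]_n => `|v|)); [exact: cus|exact: norm_continuous].
have [s1 s1ab s1max] := EVT_max ab cu.
rewrite in_itv/= in s1ab; have /andP[as1 s1b] := s1ab.
set m := `|u s1| in s1max.
have um s : a <= s <= b -> `|u s| <= m by move=> sab; apply: s1max; rewrite in_itv.
have mvt : `|u s1 - u a| <= ((p + 1) * L * (m + eps i) + V * eps i) * (s1 - a).
  apply: (@curve_mean_value _ _ u (fun s => ps i *: chart_field c (coord c (os i s)) (ts i)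
    - p *: chart_field c (coord c (o s)) t)) => // s /andP[as_ ss1].
    by apply: du; rewrite as_ (le_trans ss1).
  have sab : a <= s <= b by rewrite as_ (le_trans ss1).
  have [cs rs] := trapped s sab; have [os_ ros] := o_in s sab.
  set F1 := chart_field c _ (ts i); set F2 := chart_field c _ t.
  have -> : ps i *: F1 - p *: F2 = ps i *: (F1 - F2) + (ps i - p) *: F2.
    by rewrite scalerBr scalerBl addrA subrK.
  have tt0 : `|t - t| < r by rewrite subrr normr0.
  have [_ /(_ _ _ ros tt0 t01) F12] := rF _ _ rs tir tsi01.
  have [F2V _] := rF _ _ ros tt0 t01.
  apply: le_trans (ler_normD _ _) _; rewrite !normrZ (gtr0_norm psi0) [V * _]mulrC.
  apply: lerD; last exact: ler_pM.
  rewrite -mulrA; apply: ler_pM => //; first exact: ltW.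
  apply: le_trans F12 _; rewrite ler_wpM2l//.
  by apply: lerD => //; exact: um.
have ua : `|u a| <= Ka * eps i by [].
have B0 : 0 <= (p + 1) * L * (m + eps i) + V * eps i.
  have p10 := ltW p1; have m0 : 0 <= m := normr_ge0 _.
  by apply: addr_ge0; apply: mulr_ge0 => //; [exact: mulr_ge0|exact: addr_ge0].
have mvt2 : ((p + 1) * L * (m + eps i) + V * eps i) * (s1 - a) <=
    2 * d * ((p + 1) * L) * m + C * eps i.
  apply: le_trans (ler_wpM2l B0 (len s1 as1 s1b)) _.
  by rewrite le_eqVlt; apply/orP; left; apply/eqP; rewrite /C; ring.
have dLm : 2 * d * ((p + 1) * L) * m <= 2^-1 * m by apply: ler_wpM2r => //; exact: normr_ge0.
have Hm : m <= `|u s1 - u a| + `|u a|.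
  by have := ler_normD (u s1 - u a) (u a); rewrite subrK.
have bab : a <= b <= b by rewrite ab lexx.
have [cb _] := trapped b bab; have ubm := um b bab.
split=> //; apply: le_trans ubm _.
have -> : 2 * (Ka + C) * eps i = 2 * (Ka * eps i + C * eps i) by ring.
lra.
Unshelve. all: by end_near. Qed.

Hypothesis close_start : close_in (o 0) (o 0) (fun i => os i 0).

(** The induction starts at -1, where closeness is known by periodicity, so that
    every point of [0, 1], including 0, has close points before it. *)
Lemma close_everywhere (s : R) : -1 <= s <= 1 -> close_in (o s) (o s) (fun i => os i s).
Proof.
have N11 : -1 <= 1 :> R by lra.
move: s; apply: real_induction => //.
- have -> : o (-1) = o 0 by rewrite -(@loop_periodic _ _ _ o (-1)) addNr.
  have -> // : (fun i => os i (-1)) = (fun i => os i 0).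
  by apply/funext => i; rewrite -(@loop_periodic _ _ _ (os i) (-1)) addNr.
- move=> s _ close_s; have [d d0 [od stepd]] := close_step s.
  exists d => // s' /andP[ss' s'd] _.
  have [|K K0 KP] := stepd s _ close_s; first by rewrite subrr normr0.
  apply: (@close_in_change_chart (o s)) (mem_dom _) _.
    by apply: od; rewrite gtr0_norm ?subr_gt0// ltrBlDl.
  by exists K => //; apply: filterS KP => i; apply => //; exact: ltW.
- move=> s /andP[s1 _] close_s; have [d d0 [od stepd]] := close_step s.
  pose a := Num.max (-1) (s - d / 2).
  have as_ : a < s by rewrite gt_max s1/=; lra.
  have ad : `|a - s| < d.
    by rewrite distrC gtr0_norm ?subr_gt0// ltrBlDl -ltrBlDr lt_max; apply/orP; right; lra.
  have [|K K0 KP] := stepd a ad; first by apply: close_s; rewrite le_max lexx.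
  by exists K => //; apply: filterS KP => i; apply; [exact: ltW|rewrite ltrDl].
Qed.

Lemma close_locally_uniformly (tau : R) : 0 <= tau <= 1 ->
  exists d K, [/\ 0 < d, 0 <= K, forall s, `|s - tau| < d -> dom (o tau) (o s) &
    \forall i \near F, forall s, `|s - tau| < d ->
      dom (o tau) (os i s) /\ `|coord (o tau) (os i s) - coord (o tau) (o s)| <= K * eps i].
Proof.
move=> /andP[tau0 tau1]; have [d d0 [od stepd]] := close_step tau.
pose e := Num.min d 1 / 2.
have e0 : 0 < e by rewrite /e divr_gt0// lt_min d0 ltr01.
have ed : e <= d / 2.
  by have : Num.min d 1 <= d; [rewrite ge_min lexx|rewrite /e; lra].
have e1 : e <= 1 / 2.
  by have : Num.min d 1 <= 1; [rewrite ge_min lexx orbT|rewrite /e; lra].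
have ce : -1 <= tau - e <= 1 by apply/andP; split; lra.
have [|K K0 KP] := stepd (tau - e) _ (close_everywhere ce).
  by rewrite addrAC subrr sub0r normrN gtr0_norm//; lra.
exists e, K; split=> //.
  by move=> s se; apply: od; apply: lt_le_trans se _; lra.
by apply: filterS KP => i H s; rewrite ltr_norml => /andP[? ?]; apply: H; lra.
Qed.

End Family.
End OrbitDependence.

(** * First variation of the action *)

Section FirstVariationEstimate.
Context {R : realType} {n : nat}.

Lemma exists_pos_lower_bound (r : 'I_n -> R) : (forall j, 0 < r j) ->
  exists2 r0, 0 < r0 & forall j, r0 <= r j.
Proof.
move=> rp; exists (\big[Num.min/1]_j r j); first by elim/big_ind: _ => // a b a0 b0; rewrite lt_min a0.
by move=> j; rewrite (bigD1 j)//= ge_min lexx.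
Qed.

(** The left-hand side is the part of the derivative of s |-> A(x) (y - x), for
    curves x and y with velocities a and b, which remains after subtracting
    A(y) b - A(x) a. For a = b = w and to first order in y - x, it is the exterior
    derivative of the form A at x0, evaluated on w and y - x, and this vanishes. *)
Lemma first_variation_integrand (U : set 'rV[R]_n) (A : 'I_n -> 'rV[R]_n -> R)
    (x0 w : 'rV[R]_n) (eta : R) :
  open U -> U x0 -> (forall j, Ck 1 U (A j)) ->
  (forall u : 'rV[R]_n, \sum_j 'd (A j) x0 w * u 0 j = \sum_j 'd (A j) x0 u * w 0 j) ->
  0 < eta ->
  exists2 rho, 0 < rho & forall x y a b : 'rV[R]_n,
    `|x - x0| < rho -> `|y - x0| < rho -> `|a - w| < rho -> `|b - w| < rho ->
    `|\sum_j 'd (A j) x a * (y - x) 0 j - \sum_j (A j y - A j x) * b 0 j|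
      <= eta * `|y - x|.
Proof.
move=> oU Ux0 C1A closed eta0.
pose n1 : R := n.+1%:R; have n10 : 0 < n1 by rewrite ltr0n.
pose W := `|w| + 1; have W0 : 0 < W by rewrite ltr_wpDl.
pose eta1 := eta / (4 * n1 * W); have eta10 : 0 < eta1 by rewrite divr_gt0 ?mulr_gt0.
have H j := C1_strictly_differentiable (frame_row n) oU Ux0 (C1A j) eta10.
pose r j := s2val (cid2 (H j)).
have [r0 r00 r0r] := exists_pos_lower_bound (fun j => s2valP (cid2 (H j)) : 0 < r j).
have rd j (y : 'rV[R]_n) : `|y - x0| < r0 ->
    forall v, `|'d (A j) y v - 'd (A j) x0 v| <= eta1 * `|v|.
  by move=> yr; have [_ + _] := s2valP' (cid2 (H j)); apply; apply: lt_le_trans (r0r j).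
have rA j (y z : 'rV[R]_n) : `|y - x0| < r0 -> `|z - x0| < r0 ->
    `|A j y - A j z - 'd (A j) x0 (y - z)| <= eta1 * `|y - z|.
  move=> yr zr; have [_ _] := s2valP' (cid2 (H j)).
  by apply; apply: lt_le_trans (r0r j).
have HN j := linear_lipschitz (diff_continuous (proj1 (C1A j) x0 Ux0)).
pose N := \sum_j s2val (cid2 (HN j)).
have N0 : 0 <= N by apply: sumr_ge0 => j _; exact: ltW (s2valP (cid2 (HN j))).
have dN j (v : 'rV[R]_n) : `|'d (A j) x0 v| <= N * `|v|.
  apply: le_trans (s2valP' (cid2 (HN j)) v) _; rewrite ler_wpM2r// /N (bigD1 j)//= lerDl.
  by apply: sumr_ge0 => k _; exact: ltW (s2valP (cid2 (HN k))).
have N1 : 0 < N + 1 by rewrite ltr_wpDl.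
pose rho := Num.min r0 (Num.min 1 (eta / (4 * n1 * (N + 1)))).
have rho0 : 0 < rho by rewrite !lt_min r00 ltr01 divr_gt0 ?mulr_gt0.
have dB j (a b : 'rV[R]_n) : 'd (A j) x0 (a - b) = 'd (A j) x0 a - 'd (A j) x0 b :> R.
  exact: (linearB ('d (A j) x0) a b).
exists rho => // x y a b xr yr ar br.
(* Only the linearity of the differentials and the bounds above are used below. *)
have [D DE] : exists D : 'I_n -> 'rV[R]_n -> 'rV[R]_n -> R,
  D = fun j z v => 'd (A j) z v by eexists.
rewrite -[X in `|X - _|]/(\sum_j (fun j z v => 'd (A j) z v : R) j x a * (y - x) 0 j) -DE.
have {}rd j z : `|z - x0| < r0 -> forall v, `|D j z v - D j x0 v| <= eta1 * `|v| by rewrite DE; exact: rd.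
have {}rA j z z' : `|z - x0| < r0 -> `|z' - x0| < r0 ->
    `|A j z - A j z' - D j x0 (z - z')| <= eta1 * `|z - z'| by rewrite DE; exact: rA.
have {}dN j v : `|D j x0 v| <= N * `|v| by rewrite DE; exact: dN.
have {}dB j v v' : D j x0 (v - v') = D j x0 v - D j x0 v' by rewrite DE; exact: dB.
have {}closed (u : 'rV[R]_n) : \sum_j D j x0 w * u 0 j = \sum_j D j x0 u * w 0 j by rewrite DE; exact: closed.
clear DE.
have xr0 : `|x - x0| < r0 by move: xr; rewrite lt_min => /andP[].
have yr0 : `|y - x0| < r0 by move: yr; rewrite lt_min => /andP[].
set u := y - x.
have near_w v : `|v - w| < rho -> `|v| <= W /\ N * `|v - w| <= eta / (4 * n1).
  rewrite !lt_min => /and3P[_ v1 vN]; split.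
    by have := ler_normD (v - w) w; rewrite subrK /W; lra.
  move: vN; rewrite invfM mulrA ltr_pdivlMr// => vN; apply: le_trans (ltW vN).
  by rewrite mulrC ler_wpM2l// lerDl.
have [aW aN] := near_w a ar; have [bW bN] := near_w b br.
have etaW : eta1 * W = eta / (4 * n1).
  by rewrite /eta1; field; rewrite !gt_eqF.
have bwE j : (b - w) 0 j = b 0 j - w 0 j by rewrite !mxE.
have term j : `|D j x a * u 0 j - D j x0 w * u 0 j
    - ((A j y - A j x) * b 0 j - D j x0 u * w 0 j)| <= eta / n1 * `|u|.
  have -> : D j x a * u 0 j - D j x0 w * u 0 j
    - ((A j y - A j x) * b 0 j - D j x0 u * w 0 j) =
    (D j x a - D j x0 a) * u 0 j + D j x0 (a - w) * u 0 j
    - ((A j y - A j x - D j x0 u) * b 0 j + D j x0 u * (b - w) 0 j).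
    by rewrite (dB j a w) bwE; ring.
  have uj := coord_le_norm u j.
  have e1 : `|(D j x a - D j x0 a) * u 0 j| <= eta / (4 * n1) * `|u|.
    rewrite normrM; apply: ler_pM => //; apply: le_trans (rd j x xr0 a) _.
    by rewrite -etaW ler_wpM2l// ltW.
  have e2 : `|D j x0 (a - w) * u 0 j| <= eta / (4 * n1) * `|u|.
    by rewrite normrM; apply: ler_pM => //; apply: le_trans (dN j _) aN.
  have e3 : `|(A j y - A j x - D j x0 u) * b 0 j| <= eta / (4 * n1) * `|u|.
    rewrite normrM -etaW mulrAC; apply: ler_pM => //.
      exact: rA.
    exact: le_trans (coord_le_norm _ _) bW.
  have e4 : `|D j x0 u * (b - w) 0 j| <= eta / (4 * n1) * `|u|.
    rewrite normrM; apply: le_trans (ler_pM _ _ (dN j u) (coord_le_norm (b - w) j)) _ => //.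
    by rewrite mulrAC ler_wpM2r.
  have -> : eta / n1 * `|u| = 4 * (eta / (4 * n1) * `|u|) by field; rewrite gt_eqF.
  apply: le_trans (ler_normB _ _) _.
  apply: le_trans (lerD (le_trans (ler_normD _ _) (lerD e1 e2))
    (le_trans (ler_normD _ _) (lerD e3 e4))) _.
  by move: (eta / (4 * n1) * `|u|) => q; rewrite le_eqVlt; apply/orP; left; apply/eqP; ring.
have -> : \sum_j D j x a * u 0 j - \sum_j (A j y - A j x) * b 0 j =
  \sum_j (D j x a * u 0 j - D j x0 w * u 0 j
    - ((A j y - A j x) * b 0 j - D j x0 u * w 0 j)).
  rewrite !sumrB closed; move: (\sum_j _) (\sum_j _) (\sum_j _) => ? ? ?; ring.
apply: le_trans (ler_norm_sum _ _ _) _.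
apply: le_trans (ler_sum _ (fun j _ => term j)) _.
rewrite sumr_const card_ord -mulrnAl ler_wpM2r// -mulr_natr mulrAC ler_pdivrMr//.
by rewrite ler_wpM2l ?(ltW eta0)// ler_nat.
Qed.

End FirstVariationEstimate.

Section Forms.
Context {R : realType} {n : nat} {M : manifold R n}.
Variable alpha : M -> 'cV[R]_n.

Lemma pairingZ (k : R) (a : 'cV[R]_n) v : pairing (k *: a) v = k * pairing a v.
Proof. by rewrite /pairing -scalemxAr mxE. Qed.

Lemma pairingE (a : 'cV[R]_n) v : pairing a v = \sum_j v 0 j * a j 0.
Proof. by rewrite /pairing mxE. Qed.

Lemma pairingB (a : 'cV[R]_n) u v : pairing a (u - v) = pairing a u - pairing a v.
Proof. by rewrite /pairing mulmxBl !mxE. Qed.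

Lemma pairing_le (a : 'cV[R]_n) : exists2 N, 0 <= N & forall v, `|pairing a v| <= N * `|v|.
Proof.
exists (\sum_j `|a j 0|); first exact: sumr_ge0.
move=> v; rewrite pairingE mulr_suml; apply: le_trans (ler_norm_sum _ _ _) _.
by apply: ler_sum => j _; rewrite normrM mulrC ler_wpM2l// coord_le_norm.
Qed.

Lemma form_coef_sum c (v y : 'rV[R]_n) :
  form_coef alpha c v y = \sum_j v 0 j * form_coef alpha c (delta_mx 0 j) y.
Proof.
rewrite /form_coef /from_chart {1}(row_sum_delta v) linear_sum /pairing mulmx_suml summxE.
by apply: eq_bigr => j _; rewrite linearZ -scalemxAl mxE.
Qed.

Lemma form_coefZ c (k : R) v y : form_coef alpha c (k *: v) y = k * form_coef alpha c v y.
Proof. by rewrite !form_coef_sum mulr_sumr; apply: eq_bigr => j _; rewrite mxE mulrA. Qed.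

Lemma form_coefB c u v y :
  form_coef alpha c (u - v) y = form_coef alpha c u y - form_coef alpha c v y.
Proof.
rewrite !form_coef_sum -sumrB; apply: eq_bigr => j _.
by rewrite -mulrBl; congr (_ * _); rewrite !mxE.
Qed.

Lemma form_coef_coord c x v : dom c x ->
  form_coef alpha c v (coord c x) = pairing (alpha x) (from_chart c x v).
Proof. by move=> cx; rewrite /form_coef coordK. Qed.

Lemma form_coef_field (X : R -> M -> 'rV[R]_n) c x t : dom c x ->
  form_coef alpha c (chart_field X c (coord c x) t) (coord c x) = pairing (alpha x) (X t x).
Proof. by move=> cx; rewrite form_coef_coord// /chart_field coordK// from_chartK. Qed.

Hypothesis sm_alpha : smooth_form_on [set: M] alpha.

Lemma form_coef_C1 c v : Ck 1 (coord c @` dom c) (form_coef alpha c v).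
Proof. by have := sm_alpha c v 1%N; rewrite setIT. Qed.

Lemma form_coef_derive c (u v y : 'rV[R]_n) : (coord c @` dom c) y ->
  'D_u (form_coef alpha c v) y = \sum_j 'd (form_coef alpha c (delta_mx 0 j)) y u * v 0 j.
Proof.
move=> cy; have dA j : differentiable (form_coef alpha c (delta_mx 0 j)) y.
  by have [+ _] := form_coef_C1 c (delta_mx 0 j); apply.
have -> : form_coef alpha c v = \sum_j (v 0 j *: form_coef alpha c (delta_mx 0 j)).
  by apply/funext => z; rewrite form_coef_sum fct_sumE.
rewrite derive_sum => [|j]; last exact/diff_derivable/differentiableZ.
apply: eq_bigr => j _; rewrite deriveZ; last exact: diff_derivable.
by rewrite deriveE// mulrC.
Qed.

(** The equation d alpha(Y, .) = 0 at the centre of the chart, in coordinates. *)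
Lemma reeb_field_closed (Y : M -> 'rV[R]_n) c (u : 'rV[R]_n) (k : R) :
  (forall v, dform alpha c (Y c) v = 0) ->
  \sum_j 'd (form_coef alpha c (delta_mx 0 j)) (coord c c) (k *: Y c) * u 0 j =
  \sum_j 'd (form_coef alpha c (delta_mx 0 j)) (coord c c) u * (k *: Y c) 0 j.
Proof.
move=> reeb; have cc : (coord c @` dom c) (coord c c) by exists c => //; exact: mem_dom.
have /eqP := reeb u; rewrite /dform subr_eq0 !form_coef_derive// => /eqP H.
under eq_bigr do rewrite linearZ /= -mulrA.
under [RHS]eq_bigr do rewrite mxE mulrCA.
by rewrite -!mulr_sumr H.
Qed.

End Forms.

Section Variation.
Context {R : realType} {n : nat} {M : manifold R n}.
Variable X : R -> M -> 'rV[R]_n.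
Hypothesis smX : smooth_family X.
Context {I : Type} (F : set_system I) {FF : Filter F} (eps : I -> R).
Hypothesis eps0 : forall i, 0 <= eps i.
Hypothesis eps_cvg : eps @ F --> (0 : R).
Variables (o : loop M) (p t : R) (os : I -> loop M) (ps ts : I -> R).
Hypothesis orbit_o : orbit_space X (o, p, t).
Hypothesis orbit_os : \forall i \near F, orbit_space X (os i, ps i, ts i).
Hypothesis close_ps : \forall i \near F, `|ps i - p| <= eps i.
Hypothesis close_ts : \forall i \near F, `|ts i - t| <= eps i.
Hypothesis close_start : close_in F eps (o 0) (o 0) (fun i => os i 0).
Variables (alpha : M -> 'cV[R]_n) (C : R).
Hypothesis sm_alpha : smooth_form_on [set: M] alpha.
Hypothesis reeb : forall x, pairing (alpha x) (X t x) = 1 /\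
  forall v, dform alpha x (X t x) v = 0.
Hypothesis reeb_ts : \forall i \near F, forall x,
  `|pairing (alpha x) (X (ts i) x) - 1| <= C * `|ts i - t|.

(** The displacement from [o s] to [os i s] is measured in the chart of [o s] itself,
    whose choice depends on the point [o s] only. Hence this is 1-periodic in [s]
    and has a meaning common to all the intervals which are glued together. *)
Definition boundary_term (i : I) (s : R) : R :=
  pairing (alpha (o s)) (coord (o s) (os i s) - coord (o s) (o s)).

Lemma boundary_term_chart (c : M) (s eta : R) : dom c (o s) ->
  close_in F eps (o s) (o s) (fun i => os i s) -> 0 < eta ->
  \forall i \near F, `|form_coef alpha c (coord c (os i s) - coord c (o s)) (coord c (o s))
    - boundary_term i s| <= eta * eps i.
Proof.
move=> cs close_s eta0.
have ss := mem_dom (o s).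
have close_c : close_in F eps c (o s) (fun i => os i s) :=
  close_in_change_chart (FF := FF) eps_cvg ss cs close_s.
have [K K0 close_K] := close_c.
have [N N0 NP] := pairing_le (alpha (o s)).
have e0 : 0 < eta / ((N + 1) * (K + 1)) by rewrite divr_gt0// mulr_gt0 ?ltr_wpDl.
have H : \forall i \near F, _ :=
  close_in_cvg (FF := FF) eps_cvg cs close_c (near_change_chart cs ss e0).
apply: filterS (filterI close_K H) => i [[_ ci] [_ [_ Hi]]].
rewrite form_coef_coord// /boundary_term distrC -pairingB.
apply: le_trans (NP _) _.
apply: le_trans (ler_wpM2l N0 Hi) _.
apply: le_trans (ler_wpM2l N0 (ler_wpM2l (ltW e0) ci)) _.
have -> : N * (eta / ((N + 1) * (K + 1)) * (K * eps i)) =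
  (N / (N + 1)) * (K / (K + 1)) * (eta * eps i).
  by field; rewrite !gt_eqF ?ltr_wpDl.
rewrite -[leRHS]mul1r ler_wpM2r ?mulr_ge0 ?(ltW eta0)//.
have le1 (z : R) : 0 <= z -> 0 <= z / (z + 1) <= 1.
  move=> z0; have z1 : 0 < z + 1 by rewrite ltr_wpDl.
  apply/andP; split; first by rewrite divr_ge0// ltW.
  by rewrite ler_pdivrMr// mul1r lerDl.
have /andP[? ?] := le1 N N0; have /andP[? ?] := le1 K K0.
by rewrite mulr_ile1.
Qed.

Definition varies_linearly (eta a b : R) := \forall i \near F,
  `|boundary_term i b - boundary_term i a - (b - a) * (ps i - p)|
  <= (b - a) * (eta * eps i + C * ps i * `|ts i - t|).

Lemma varies_linearly_add (eta a b c : R) :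
  varies_linearly eta a b -> varies_linearly eta b c -> varies_linearly eta a c.
Proof.
move=> Hab Hbc; apply: filterS (filterI Hab Hbc) => i [H1 H2].
have -> : boundary_term i c - boundary_term i a - (c - a) * (ps i - p) =
  (boundary_term i b - boundary_term i a - (b - a) * (ps i - p)) +
  (boundary_term i c - boundary_term i b - (c - b) * (ps i - p)) by ring.
apply: le_trans (ler_normD _ _) _; apply: le_trans (lerD H1 H2) _.
by rewrite -mulrDl (_ : b - a + (c - b) = c - a)//; ring.
Qed.

Lemma form_coef_curve_is_derive (c : M) (x y : R -> 'rV[R]_n) (a b : 'rV[R]_n) (s : R) :
  (coord c @` dom c) (x s) -> is_derive s 1 x a -> is_derive s 1 y b ->
  is_derive s 1 (fun s => form_coef alpha c (y s - x s) (x s))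
    (\sum_j 'd (form_coef alpha c (delta_mx 0 j)) (x s) a * (y s - x s) 0 j
     + form_coef alpha c (b - a) (x s)).
Proof.
move=> cx dx dy; rewrite (form_coef_sum _ _ (b - a)) -big_split/=.
have -> : (fun s => form_coef alpha c (y s - x s) (x s)) =
  \sum_j (fun s => form_coef alpha c (delta_mx 0 j) (x s) * (y s - x s) 0 j).
  by apply/funext => v; rewrite form_coef_sum fct_sumE; apply: eq_bigr => j _; rewrite mulrC.
apply: is_derive_sum => j.
have dA : is_derive s 1 (form_coef alpha c (delta_mx 0 j) \o x)
    ('d (form_coef alpha c (delta_mx 0 j)) (x s) a).
  apply: is_derive_comp_diff => //.
  by have [+ _] := form_coef_C1 sm_alpha c (delta_mx 0 j); apply.
have du : is_derive s 1 (fun s => (y s - x s) 0 j) ((b - a) 0 j).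
  have [/derivable_mxP du1 du2] := is_deriveB dy dx; apply: DeriveDef => //.
  by rewrite -du2 derive_mx ?mxE//; apply/derivable_mxP.
have H := is_deriveM dA du; apply: (is_derive_eq H).
by rewrite addrC; congr (_ + _); rewrite /GRing.scale/= mulrC.
Qed.

(** In the chart of the tag, [boundary_term] differs by o(eps) from the quantity
    [phi] below. The derivative of [phi] is within o(eps) of
    alpha(d o_i/ds) - alpha(d o/ds) by [first_variation_integrand], and this
    difference is p_i - p up to C p_i |t_i - t|. The value of [phi] is compared
    with [boundary_term] at the two ends [a] and [b] only, so that an error
    proportional to [b - a] can be afforded there. *)
Lemma varies_linearly_near (tau eta : R) : 0 <= tau <= 1 -> 0 < eta ->
  exists2 d, 0 < d & forall a b, 0 <= a -> a <= tau -> tau <= b -> b <= 1 -> a < b ->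
    tau - d < a -> b < tau + d -> varies_linearly eta a b.
Proof.
move=> tau01 eta0; have [p0 t01 _ _] := orbit_o.
have [d1 [K [d10 K0 od oK]]] := close_locally_uniformly smX eps0 eps_cvg orbit_o
  orbit_os close_ps close_ts close_start tau01.
pose c := o tau; rewrite -/c in od oK; have cc := mem_dom c.
have cc' : (coord c @` dom c) (coord c c) by exists c.
have [r [L [V [r0 L0 V0 rim rF]]]] := chart_field_locally_lipschitz smX cc t01.
have F0 : chart_field X c (coord c c) t = X t c by rewrite /chart_field coordK// to_chart_id.
pose A j := form_coef alpha c (delta_mx 0 j).
pose w := p *: X t c.
have K1 : 0 < K + 1 by rewrite ltr_wpDl.
have eta1 : 0 < eta / 2 / (K + 1) by rewrite !divr_gt0.
have [rho rho0 rhoP] := first_variation_integrand (@open_coord _ _ M c) cc'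
  (fun j => form_coef_C1 sm_alpha c (delta_mx 0 j))
  (fun u => reeb_field_closed sm_alpha u p (proj2 (reeb c))) eta1.
have p1 : 0 < p + 1 by rewrite addr_gt0.
pose D := (p + 1) * (3 * L) + V + 1.
have D0 : 0 < D by rewrite ltr_wpDl// addr_ge0// !mulr_ge0// ltW.
(* Within distance q of the tag, points are in the ball where the vector field is
   Lipschitz, and points and velocities are in the domain of rhoP. *)
pose q := Num.min (Num.min (r / 3) (rho / 3)) (Num.min 1 (rho / D)).
have q0 : 0 < q by rewrite !lt_min !divr_gt0// ltr01.
have qr : 3 * q <= r.
  by have : q <= r / 3; [rewrite !ge_min lexx|lra].
have qrho : 3 * q <= rho.
  by have : q <= rho / 3; [rewrite !ge_min lexx orbT|lra].
have q1 : q <= 1 by rewrite !ge_min lexx !orbT.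
have q_3q : q <= 3 * q by rewrite ler_pMl// ler1n.
have q2_3q : 2 * q < 3 * q by rewrite ltr_pM2r// ltr_nat.
have q2_q : 2 * q + q <= 3 * q by lra.
have q_r : q < r by rewrite (lt_le_trans _ qr)// ltr_pMl// ltr1n.
have q_rho : q < rho by rewrite (lt_le_trans _ qrho)// ltr_pMl// ltr1n.
have qD : q * D <= rho by rewrite -ler_pdivlMr// !ge_min lexx !orbT.
have qD' : (p + 1) * (L * (3 * q)) + q * V < rho.
  apply: lt_le_trans qD.
  have -> : q * D = (p + 1) * (L * (3 * q)) + q * V + q by rewrite /D; ring.
  by rewrite ltrDl.
have [d2 /= d20 d2P] : exists2 d2, 0 < d2 & forall s, `|s - tau| < d2 ->
    dom c (o s) /\ `|coord c (o s) - coord c c| < q.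
  have := @loop_continuous _ _ _ o tau _ (near_coord cc q0) => /nbhs_normP[d2 /= d20 dP].
  by exists d2 => // s sd; apply: dP; rewrite /= distrC.
exists (Num.min d1 d2); first by rewrite lt_min d10.
move=> a b a0 atau taub b1 ab da db.
have near_tau s : a <= s <= b -> `|s - tau| < d1 /\ `|s - tau| < d2.
  move=> /andP[as_ sb].
  have : `|s - tau| < Num.min d1 d2.
    by rewrite ltr_distl (lt_le_trans da as_) (le_lt_trans sb db).
  by rewrite lt_min => /andP.
have aab : a <= a <= b by rewrite lexx ltW.
have bab : a <= b <= b by rewrite lexx ltW.
have a11 : -1 <= a <= 1 by rewrite (le_trans (lerN10 R) a0) (le_trans (ltW ab) b1).
have b11 : -1 <= b <= 1 by rewrite (le_trans (lerN10 R) (le_trans a0 (ltW ab))) b1.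
have ba0 : 0 < b - a by rewrite subr_gt0.
have e4 : 0 < (b - a) * (eta / 4) by rewrite mulr_gt0 ?divr_gt0.
have close s : -1 <= s <= 1 -> close_in F eps (o s) (o s) (fun i => os i s).
  exact: (close_everywhere smX eps0 eps_cvg orbit_o orbit_os close_ps close_ts close_start).
have ca := boundary_term_chart (proj1 (d2P a (proj2 (near_tau a aab)))) (close a a11) e4.
have cb := boundary_term_chart (proj1 (d2P b (proj2 (near_tau b bab)))) (close b b11) e4.
pose phi i s := form_coef alpha c (coord c (os i s) - coord c (o s)) (coord c (o s)).
rewrite /varies_linearly; near=> i.
have Ha : `|phi i a - boundary_term i a| <= (b - a) * (eta / 4) * eps i by near: i.
have Hb : `|phi i b - boundary_term i b| <= (b - a) * (eta / 4) * eps i by near: i.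
have orb : orbit_space X (os i, ps i, ts i) by near: i.
have [psi0 tsi01 _ _] := orb.
have psi : `|ps i - p| <= eps i by near: i.
have tsi : `|ts i - t| <= eps i by near: i.
have reebi x : `|pairing (alpha x) (X (ts i) x) - 1| <= C * `|ts i - t|.
  by move: x; near: i.
have osK s : `|s - tau| < d1 -> dom c (os i s) /\
    `|coord c (os i s) - coord c (o s)| <= K * eps i by move: s; near: i.
have e1 : 1 * eps i < q by near: i; exact: (near_eps (FF := FF) eps_cvg).
have eK : K * eps i < q by near: i; exact: (near_eps (FF := FF) eps_cvg).
rewrite mul1r in e1.
have psp : ps i <= p + 1.
  by rewrite -lerBlDl (le_trans (ler_norm _))// (le_trans psi)// (le_trans (ltW e1)).
have tir : `|ts i - t| < r := le_lt_trans tsi (lt_trans e1 q_r).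
have tt0 : `|t - t| < r by rewrite subrr normr0.
pose x s := coord c (o s); pose y s := coord c (os i s).
pose va s := p *: chart_field X c (x s) t.
pose vb s := ps i *: chart_field X c (y s) (ts i).
pose dphi s := \sum_j 'd (A j) (x s) (va s) * (y s - x s) 0 j
     + form_coef alpha c (vb s - va s) (x s).
have dphiP s : a <= s <= b -> is_derive s 1 (phi i) (dphi s).
  move=> /near_tau[s1 s2]; have [cs xs] := d2P s s2; have [cis yxs] := osK s s1.
  apply: form_coef_curve_is_derive; first by exists (o s).
    exact: orbit_is_derive.
  exact: orbit_is_derive.
have dphi_bound s : a <= s <= b ->
    `|dphi s - (ps i - p)| <= eta / 2 * eps i + C * ps i * `|ts i - t|.
  move=> /near_tau[s1 s2]; have [cs xs] := d2P s s2; have [cis yxs] := osK s s1.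
  rewrite -/(x s) -/(y s) in xs yxs.
  have ys : `|y s - coord c c| < 2 * q.
    rewrite -(subrK (x s) (y s)) -addrA (_ : 2 * q = q + q); last by rewrite mulr_natl mulr2n.
    apply: le_lt_trans (ler_normD _ _) _.
    exact: ltrD (le_lt_trans yxs eK) xs.
  have xr : `|x s - coord c c| < r := lt_trans xs q_r.
  have yr : `|y s - coord c c| < r := lt_trans ys (lt_le_trans q2_3q qr).
  have x0r : `|coord c c - coord c c| < r by rewrite subrr normr0.
  have va_p : form_coef alpha c (va s) (x s) = p.
    by rewrite form_coefZ form_coef_field// (proj1 (reeb _)) mulr1.
  have vb_p : form_coef alpha c (vb s) (y s) = ps i * pairing (alpha (os i s)) (X (ts i) (os i s)).
    by rewrite form_coefZ form_coef_field.
  pose k := pairing (alpha (os i s)) (X (ts i) (os i s)).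
  have -> : dphi s - (ps i - p) =
    (\sum_j 'd (A j) (x s) (va s) * (y s - x s) 0 j
     - \sum_j (A j (y s) - A j (x s)) * vb s 0 j) + ps i * (k - 1).
    have -> : \sum_j (A j (y s) - A j (x s)) * vb s 0 j =
        ps i * k - form_coef alpha c (vb s) (x s).
      rewrite -vb_p !(form_coef_sum _ c (vb s)) -sumrB; apply: eq_bigr => j _.
      by rewrite mulrBl mulrC [X in _ - X]mulrC.
    rewrite /dphi form_coefB va_p; move: (\sum_j _) (form_coef _ _ _ _) => S f.
    by ring.
  have wlip y' t' : `|y' - coord c c| < r -> `|t' - t| < r -> 0 <= t' <= 1 ->
      `|chart_field X c y' t' - X t c| <= L * (`|y' - coord c c| + `|t' - t|).
    by move=> y'r t'r t'01; rewrite -F0; have [_] := rF _ _ y'r t'r t'01; apply.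
  have Lq z : z <= 3 * q -> L * z <= L * (3 * q) by move=> zq; rewrite ler_wpM2l.
  have va_w : `|va s - w| < rho.
    apply: le_lt_trans qD'; rewrite -[leLHS]addr0 /va /w -scalerBr normrZ gtr0_norm//.
    apply: lerD; last by rewrite mulr_ge0// ltW.
    apply: ler_pM => //; [exact: ltW|by rewrite lerDl|].
    apply: le_trans (wlip _ _ xr tt0 t01) _; apply: Lq.
    by rewrite subrr normr0 addr0 (le_trans (ltW xs)).
  have vb_w : `|vb s - w| < rho.
    apply: le_lt_trans qD'.
    have -> : vb s - w = ps i *: (chart_field X c (y s) (ts i) - X t c) + (ps i - p) *: X t c.
      by rewrite /vb /w scalerBr scalerBl addrA subrK.
    apply: le_trans (ler_normD _ _) _; rewrite !normrZ (gtr0_norm psi0).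
    apply: lerD; apply: ler_pM => //.
    - exact: ltW.
    - apply: le_trans (wlip _ _ yr tir tsi01) (Lq _ _).
      exact: le_trans (lerD (ltW ys) (le_trans tsi (ltW e1))) q2_q.
    - by apply: le_trans psi _; exact: ltW.
    - by rewrite -F0; have [] := rF _ _ x0r tt0 t01.
  apply: le_trans (ler_normD _ _) _; apply: lerD.
    have xrho : `|x s - coord c c| < rho := lt_trans xs q_rho.
    have yrho : `|y s - coord c c| < rho := lt_trans ys (lt_le_trans q2_3q qrho).
    apply: le_trans (rhoP _ _ _ _ xrho yrho va_w vb_w) _.
    apply: le_trans (ler_wpM2l (ltW eta1) yxs) _.
    have -> : eta / 2 / (K + 1) * (K * eps i) = eta / 2 * eps i * (K / (K + 1)).
      by field; rewrite gt_eqF.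
    apply: ler_piMr; first by rewrite mulr_ge0// divr_ge0// ltW.
    by rewrite ler_pdivrMr// mul1r lerDl.
  rewrite normrM (gtr0_norm psi0) [C * _]mulrC -mulrA.
  by apply: (ler_wpM2l (ltW psi0)); exact: reebi.
have [v0 v0ab mvt] : exists2 v, a <= v <= b & phi i b - phi i a = dphi v * (b - a).
  have [] := @MVT_segment R (phi i) dphi a b (ltW ab).
  - by move=> v; rewrite in_itv/= => /andP[av vb']; apply: dphiP; rewrite !ltW.
  - apply: derivable_within_continuous => v; rewrite in_itv/= => vab.
    by have [] := dphiP v vab.
  - by move=> v; rewrite in_itv/=; exists v.
have Hv := dphi_bound v0 v0ab.
have -> : boundary_term i b - boundary_term i a - (b - a) * (ps i - p) =
  (phi i a - boundary_term i a) - (phi i b - boundary_term i b)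
  + (b - a) * (dphi v0 - (ps i - p)).
  have -> : (b - a) * (dphi v0 - (ps i - p)) = phi i b - phi i a - (b - a) * (ps i - p).
    by rewrite mvt; ring.
  by ring.
apply: le_trans (ler_normD _ _) _; rewrite normrM (gtr0_norm ba0).
apply: le_trans (lerD (le_trans (ler_normB _ _) (lerD Ha Hb)) (ler_wpM2l (ltW ba0) Hv)) _.
by rewrite le_eqVlt; apply/orP; left; apply/eqP; field.
Unshelve. all: by end_near.
Qed.

Lemma period_variation (eta : R) : 0 < eta ->
  \forall i \near F, `|ps i - p| <= C * ps i * `|ts i - t| + eta * eps i.
Proof.
move=> eta0; have H : varies_linearly eta 0 1.
  apply: interval_additive_induction => //; last by move=> tau tau01; exact: varies_linearly_near.
  by move=> a b c _ _ _ _; exact: varies_linearly_add.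
apply: filterS H => i; rewrite subr0 !mul1r.
have period (u : loop M) : u 1 = u 0 by rewrite -(@loop_periodic _ _ _ u 0) add0r.
have -> : boundary_term i 1 = boundary_term i 0 by rewrite /boundary_term !period.
by rewrite subrr sub0r normrN (addrC (C * _ * _)).
Qed.

End Variation.

(** * Logarithmic variation of the contact forms *)

(** Compactness, as near-covering with respect to the filter of large constants. *)
Lemma compact_uniform_constant (R : realType) (T : topologicalType) (A : set T)
    (P : R -> T -> Prop) :
  compact A -> (forall K K' x, K <= K' -> P K x -> P K' x) ->
  (forall x, A x -> exists K, \forall y \near x, P K y) ->
  exists K, forall x, A x -> P K x.
Proof.
move=> cA mono loc.
have /filter_ex[K KP] : \forall K \near +oo%R, A `<=` P K.
  apply: (proj1 (compact_near_coveringP _) cA R (pinfty_nbhs R) P _) => x Ax.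
  have [K KP] := loc x Ax; have K_oo : \forall K' \near +oo%R, K <= K' by exact: nbhs_pinfty_ge (num_real _).
  by exists (P K, [set K' | K <= K']) => //= -[y K'] /= [Py KK']; exact: mono KK' Py.
by exists K.
Qed.

Section UniformConstant.
Context {R : realType} {n : nat} {M : manifold R n}.
Variables (X : R -> M -> 'rV[R]_n) (lambda : M -> 'cV[R]_n).
Hypothesis smX : smooth_family X.
Hypothesis sm_lambda : smooth_form_on [set: M] lambda.
Hypothesis lambda_pos : forall t x, 0 <= t <= 1 -> 0 < pairing (lambda x) (X t x).

Let h t x := pairing (lambda x) (X t x).

(** [h t x] is Lipschitz in [t], because the vector field is, and it is bounded
    below near [x0] and [t0], because it is continuous and positive there. *)
Lemma pairing_log_lipschitz_near (x0 : M) (t0 : R) : 0 <= t0 <= 1 ->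
  exists2 e, 0 < e & exists2 K, 0 <= K & \forall x \near x0, forall t t',
    0 <= t <= 1 -> 0 <= t' <= 1 -> `|t - t0| < e -> `|t' - t0| < e ->
    `|h t' x - h t x| <= K * `|t' - t| * h t x.
Proof.
move=> t01; set c := x0; have cc : dom c x0 by exact: mem_dom.
have [r [L [V [r0 L0 V0 rim rF]]]] := chart_field_locally_lipschitz smX cc t01.
pose y0 : 'rV[R]_n := coord c x0; rewrite -/y0 in rim rF.
have y0_filter : Filter (nbhs y0) := nbhs_filter y0.
have hE x t : dom c x -> h t x = form_coef lambda c (chart_field X c (coord c x) t) (coord c x).
  by move=> cx; rewrite form_coef_field.
pose A j := form_coef lambda c (delta_mx 0 j).
have cA v : {for y0, continuous (form_coef lambda c v)}.
  by have := sm_lambda c v 0%N; rewrite setIT; apply; exists x0.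
pose B := \sum_j (`|A j y0| + 1).
have B0 : 0 <= B by apply: sumr_ge0 => j _; rewrite addr_ge0.
have nearB : \forall y \near y0, forall v, `|form_coef lambda c v y| <= B * `|v|.
  have : \forall y \near y0, forall j : 'I_n, `|A j y0 - A j y| <= 1.
    refine (@filter_forall _ _ (fun j y => `|A j y0 - A j y| <= 1) (nbhs y0) _ _) => j.
    by move/cvgrPdist_le : (cA (delta_mx 0 j)) => /(_ 1 ltr01).
  apply: filterS => y Ay v; rewrite form_coef_sum mulr_suml.
  apply: le_trans (ler_norm_sum _ _ _) _; apply: ler_sum => j _.
  rewrite normrM mulrC; apply: ler_pM => //; last exact: coord_le_norm.
  have := Ay j; have := ler_normD (A j y - A j y0) (A j y0); rewrite subrK distrC /A; lra.
have h0 := lambda_pos x0 t01; set k := pairing _ _ in h0.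
have k4 : 0 < k / 4 by rewrite divr_gt0.
have nearA : \forall y \near y0, `|form_coef lambda c (chart_field X c y0 t0) y0
    - form_coef lambda c (chart_field X c y0 t0) y| <= k / 4.
  by move/cvgrPdist_le : (cA (chart_field X c y0 t0)) => /(_ _ k4).
have B1 : 0 < 8 * (B + 1) * (L + 1) by rewrite !mulr_gt0// ltr_wpDl.
pose e := Num.min r (k / (8 * (B + 1) * (L + 1))).
have e0 : 0 < e by rewrite lt_min r0 divr_gt0.
have er : e <= r by rewrite ge_min lexx.
have BLe : B * (L * (2 * e)) <= k / 4.
  have : e <= k / (8 * (B + 1) * (L + 1)) by rewrite ge_min lexx orbT.
  rewrite ler_pdivlMr// => H.
  have -> : B * (L * (2 * e)) = (e * (8 * (B + 1) * (L + 1)) - 8 * e * (B + L + 1)) / 4.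
    by field.
  have : 0 <= 8 * e * (B + L + 1) by rewrite !mulr_ge0// ?addr_ge0// ltW.
  lra.
have nearE : \forall y \near y0, `|y - y0| < e.
  exact: near_dist_lt.
exists e => //; exists (2 * (B * L) / k).
  by rewrite divr_ge0 ?(ltW h0)// !mulr_ge0.
have Hnear := @filterI _ (nbhs y0) y0_filter _ _
  (@filterI _ (nbhs y0) y0_filter _ _ nearB nearA) nearE.
have Hx : \forall x \near x0, dom c x /\
    (((forall v, `|form_coef lambda c v (coord c x)| <= B * `|v|) /\
     `|form_coef lambda c (chart_field X c y0 t0) y0
       - form_coef lambda c (chart_field X c y0 t0) (coord c x)| <= k / 4) /\
     `|coord c x - y0| < e).
  have Hc : nbhs x0 (coord c @^-1` _) := continuous_coord cc Hnear.
  by apply: filterS (filterI (near_dom cc) Hc) => x [cx H].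
apply: filterS Hx => x [cx [[Bx Ax] ex]] t t' t1 t'1 te t'e.
have tr s : `|s - t0| < e -> `|s - t0| < r by move=> se; apply: lt_le_trans er.
have xr := lt_le_trans ex er; have y0r : `|y0 - y0| < r by rewrite subrr normr0.
have t0r : `|t0 - t0| < r by rewrite subrr normr0.
have [_ dF] := rF _ _ xr (tr t' t'e) t'1.
have [_ dF0] := rF _ _ xr (tr t te) t1.
have kE : k = form_coef lambda c (chart_field X c y0 t0) y0 by rewrite -hE.
have hk : k / 2 <= h t x.
  rewrite hE//; set f := form_coef lambda c (chart_field X c (coord c x) t) (coord c x).
  have : `|f - form_coef lambda c (chart_field X c y0 t0) (coord c x)| <= k / 4.
    rewrite -form_coefB; apply: le_trans (Bx _) _; apply: le_trans _ BLe.
    rewrite ler_wpM2l//; apply: le_trans (dF0 _ _ y0r t0r t01) _.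
    by rewrite ler_wpM2l//; lra.
  move: Ax; rewrite -kE !ler_norml; lra.
have -> : h t' x - h t x = form_coef lambda c
    (chart_field X c (coord c x) t' - chart_field X c (coord c x) t) (coord c x).
  by rewrite form_coefB -!hE.
apply: le_trans (Bx _) _.
apply: le_trans (ler_wpM2l B0 (dF _ _ xr (tr t te) t1)) _.
rewrite subrr normr0 add0r.
have -> : 2 * (B * L) / k * `|t' - t| * h t x = B * (L * `|t' - t|) * (h t x / (k / 2)).
  by field; rewrite gt_eqF.
rewrite ler_peMr ?mulr_ge0// ler_pdivlMr ?divr_gt0// mul1r//.
Qed.

(** Compactness of [M] gives a constant for each [t0], valid for parameters near
    [t0]; compactness of [0, 1] then gives a common one. *)
Lemma pairing_log_lipschitz : compact [set: M] -> exists2 C, 0 < C &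
  forall t, 0 <= t <= 1 -> exists2 e, 0 < e & forall t' x, 0 <= t' <= 1 ->
    `|t' - t| < e -> `|h t' x - h t x| <= C * `|t' - t| * h t x.
Proof.
move=> cM.
have mono_ineq (K K' t t' : R) x : K <= K' -> 0 <= t <= 1 ->
    `|h t' x - h t x| <= K * `|t' - t| * h t x -> `|h t' x - h t x| <= K' * `|t' - t| * h t x.
  move=> KK' t01 /le_trans; apply; rewrite ler_wpM2r//; first exact/ltW/lambda_pos.
  by rewrite ler_wpM2r.
pose unif (K t0 : R) := exists2 e, 0 < e & forall x t t', 0 <= t <= 1 -> 0 <= t' <= 1 ->
  `|t - t0| < e -> `|t' - t0| < e -> `|h t' x - h t x| <= K * `|t' - t| * h t x.
have unif_ex t0 : 0 <= t0 <= 1 -> exists K, unif K t0.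
  move=> t01.
  (* K is both a Lipschitz constant and the inverse of a radius, so that P is
     monotone in K. *)
  pose P (K : R) x := forall t t', 0 <= t <= 1 -> 0 <= t' <= 1 ->
    K * `|t - t0| < 1 -> K * `|t' - t0| < 1 -> `|h t' x - h t x| <= K * `|t' - t| * h t x.
  have [||K KP] := @compact_uniform_constant R M setT P cM.
  - move=> K K' x KK' PK t t' t1 t'1 te t'e; apply: (mono_ineq K) => //.
    by apply: PK => //; [apply: le_lt_trans te|apply: le_lt_trans t'e]; rewrite ler_wpM2r.
  - move=> x _; have [e e0 [K K0 KP]] := pairing_log_lipschitz_near x t01.
    exists (Num.max K e^-1); apply: filterS KP => y Hy t t' t1 t'1 te t'e.
    apply: (mono_ineq K) => //; first by rewrite le_max lexx.
    have small s : Num.max K e^-1 * `|s - t0| < 1 -> `|s - t0| < e.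
      move=> H; have : e^-1 * `|s - t0| < 1.
        by apply: le_lt_trans H; rewrite ler_wpM2r// le_max lexx orbT.
      by rewrite ltr_pdivrMl// mulr1.
    by apply: Hy => //; exact: small.
  exists K; exists (`|K| + 1)^-1; first by rewrite invr_gt0 ltr_wpDl.
  have small s : `|s - t0| < (`|K| + 1)^-1 -> K * `|s - t0| < 1.
    move=> se; have K1 : 0 < `|K| + 1 by rewrite ltr_wpDl.
    apply: (@le_lt_trans _ _ ((`|K| + 1) * `|s - t0|)).
      by rewrite ler_wpM2r//; apply: le_trans (ler_norm _) _; rewrite lerDl.
    by rewrite -ltr_pdivlMl// mulr1.
  by move=> x t t' t1 t'1 te t'e; apply: KP => //; exact: small.
have [||K KP] := @compact_uniform_constant R R `[0, 1]%classic (fun K t => 0 <= t <= 1 -> unif K t) (@segment_compact _ _ _).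
- move=> K K' t KK' H t01; have [e e0 eP] := H t01.
  by exists e => // x s s' s1 s'1 se s'e; apply: (mono_ineq K) => //; exact: eP.
- move=> t0; rewrite /= in_itv/= => t01; have [K [e e0 eP]] := unif_ex t0 t01.
  have e2 : 0 < e / 2 by rewrite divr_gt0.
  exists K; apply: filterS (near_dist_lt t0 e2) => t tt0 t1; exists (e / 2) => // x s s' s1 s'1 st s't.
  apply: eP => //.
    by have := ler_normD (s - t) (t - t0); rewrite addrA subrK; lra.
  by have := ler_normD (s' - t) (t - t0); rewrite addrA subrK; lra.
exists (`|K| + 1); first by rewrite ltr_wpDl.
move=> t t01; have [|e e0 eP] := KP t _ t01; first by rewrite /= in_itv.
exists e => // t' x t'1 t'e; apply: (mono_ineq K) => //.
  by apply: le_trans (ler_norm _) _; rewrite lerDl.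
by apply: eP => //; rewrite subrr normr0.
Qed.

End UniformConstant.

(** * Growth of the period along a path of closed orbits *)

Section Logarithm.
Context {R : realType}.

Lemma ln_lipschitz (k u v : R) : 0 < k -> k <= u -> k <= v -> `|ln u - ln v| <= `|u - v| / k.
Proof.
move=> k0; wlog vu : u v / v <= u.
  move=> H ku kv; have [/H/(_ ku kv)|/ltW/H/(_ kv ku)//] := leP v u; first exact.
  by rewrite distrC (distrC v).
move=> ku kv; have u0 := lt_le_trans k0 ku; have v0 := lt_le_trans k0 kv.
rewrite (ger0_norm (_ : 0 <= u - v)) ?subr_ge0//.
rewrite ger0_norm; last by rewrite subr_ge0 ler_ln.
rewrite -ln_div ?posrE//.
have -> : u / v = 1 + (u - v) / v by field; rewrite gt_eqF.
apply: le_trans (le_ln1Dx _) _.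
  by apply: lt_le_trans (ltrN10 _) _; rewrite divr_ge0 ?subr_ge0// ltW.
by rewrite ler_wpM2l ?subr_ge0// lef_pV2.
Qed.

Lemma metric_derivative_ge0 (q : R -> R) (a : R) : 0 <= a -> (0 <= metric_derivative q a)%E.
Proof.
move=> a0; apply: limf_esup_ge0 => [|s]; last by rewrite lee_fin divr_ge0.
rewrite /within /= => -[e /= e0 eP].
have ae : `|a - (a + e / 2)| < e.
  by rewrite opprD addrA subrr sub0r normrN gtr0_norm; lra.
apply: (eP (a + e / 2)) => //=; first by rewrite gt_eqF// ltrDl divr_gt0.
by rewrite addr_ge0// divr_ge0// ltW.
Qed.

Lemma near_ge0 (a : R) : 0 < a -> \forall s \near a, 0 <= s.
Proof.
move=> a0; apply/nbhs_normP; exists a => // s /=.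
by rewrite ltr_norml => /andP[_]; rewrite ltrBlDr ltrDl => /ltW.
Qed.

Lemma metric_derivative_lt (q : R -> R) (a k : R) : 0 < a ->
  (metric_derivative q a < k%:E)%E ->
  exists2 k1, k1 < k & \forall s \near a, `|q s - q a| <= k1 * `|s - a|.
Proof.
move=> a0 /[dup] qk /ereal_inf_lt[_ [V FV <-] supV].
have q0 := metric_derivative_ge0 q (ltW a0).
have supV0 : (0 <= ereal_sup ((fun s => (`|q a - q s| / `|a - s|)%:E) @` V))%E.
  by apply: le_trans q0 _; apply: ereal_inf_lbound; exists V.
case Es : (ereal_sup _) supV0 supV => [k1| |]//= _; rewrite lte_fin => k1k.
exists k1 => //; have pos : \forall s \near a, 0 <= s by exact: near_ge0.
have [e /= e0 eP] := FV.
have ball_e : \forall s \near a, `|a - s| < e by apply/nbhs_normP; exists e.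
apply: filterS (filterI pos ball_e) => s [s0 se].
have [->|sa] := eqVneq s a; first by rewrite !subrr normr0 mulr0.
have Vs : V s by exact: eP.
have : ((`|q a - q s| / `|a - s|)%:E <= k1%:E)%E.
  by rewrite -Es; apply: ereal_sup_ubound; exists s.
rewrite lee_fin ler_pdivrMr ?normr_gt0 ?subr_eq0 1?eq_sym//.
by rewrite distrC (distrC a).
Qed.

End Logarithm.

Section PeriodGrowth.
Context {R : realType} {n : nat} {M : manifold R n}.
Variables (X : R -> M -> 'rV[R]_n) (g : M -> 'M[R]_n) (lambda : M -> 'cV[R]_n) (C : R).
Hypothesis smX : smooth_family X.
Hypothesis metric_g : riemannian_metric g.
Hypothesis C0 : 0 < C.
Hypothesis log_lip : forall t, 0 <= t <= 1 -> exists2 e, 0 < e &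
  forall t' x, 0 <= t' <= 1 -> `|t' - t| < e ->
    `|pairing (lambda x) (X t' x) - pairing (lambda x) (X t x)|
    <= C * `|t' - t| * pairing (lambda x) (X t x).
Hypothesis reeb : forall t, 0 <= t <= 1 -> exists f : M -> R,
  [/\ forall x, 0 < f x, smooth_form_on [set: M] (fun x => f x *: lambda x) &
    forall x, pairing (f x *: lambda x) (X t x) = 1 /\
      forall v, dform (fun x => f x *: lambda x) x (X t x) v = 0].
Variable P : R -> loop M * R * R.
Hypothesis orbit_P : forall tau, 0 <= tau -> orbit_space X (P tau).
Hypothesis lip_P : locally_lipschitz (orbit_dist g) P.

Let per tau := (P tau).1.2.
Let par tau := (P tau).2.
Let orb tau := (P tau).1.1.

Lemma orbit_P_split tau : 0 <= tau -> orbit_space X (orb tau, per tau, par tau).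
Proof. by move=> /orbit_P; rewrite /orb /per /par; case: (P tau) => -[]. Qed.

Lemma per_gt0 tau : 0 <= tau -> 0 < per tau.
Proof. by move=> /orbit_P_split[]. Qed.

Lemma orbit_dist_le (z z' : loop M * R * R) (l : R) : (orbit_dist g z z' <= l%:E)%E ->
  [/\ (riemannian_dist g (z.1.1 0%R) (z'.1.1 0%R) <= l%:E)%E, `|z.1.2 - z'.1.2| <= l & `|z.2 - z'.2| <= l].
Proof.
rewrite /orbit_dist; have := riemannian_dist_ge0 g (z.1.1 0) (z'.1.1 0).
case: (riemannian_dist _ _ _) => [d| |]//; rewrite !lee_fin => d0 H.
have h1 := normr_ge0 (z.1.2 - z'.1.2); have h2 := normr_ge0 (z.2 - z'.2).
by split; lra.
Qed.

Lemma per_locally_lipschitz a : 0 <= a -> exists d K, 0 < d /\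
  forall b c, 0 <= b -> 0 <= c -> `|b - a| < d -> `|c - a| < d ->
    `|per b - per c| <= K * `|b - c|.
Proof.
move=> /lip_P[d [K [d0 dK]]]; exists d, K; split=> // b c b0 c0 bd cd.
by have [_] := orbit_dist_le (dK b c b0 c0 bd cd).
Qed.

Lemma near_per (a k : R) : 0 <= a -> 0 < k -> exists2 d, 0 < d &
  forall b, 0 <= b -> `|b - a| < d -> `|per b - per a| < k.
Proof.
move=> a0 k0; have [d [K [d0 dK]]] := per_locally_lipschitz a0.
have K1 : 0 < `|K| + 1 by rewrite ltr_wpDl.
exists (Num.min d (k / (`|K| + 1))); first by rewrite lt_min d0 divr_gt0.
move=> b b0; rewrite lt_min => /andP[bd bk].
have := dK b a b0 a0 bd; rewrite subrr normr0 => /(_ d0) H.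
apply: le_lt_trans H _; move: bk; rewrite ltr_pdivlMr// mulrC; apply: le_lt_trans.
by rewrite ler_wpM2r//; apply: le_trans (ler_norm _) _; rewrite lerDl.
Qed.

Lemma log_per_locally_lipschitz a : 0 <= a -> exists d K, 0 < d /\
  forall b c, 0 <= b -> 0 <= c -> `|b - a| < d -> `|c - a| < d ->
    `|ln (per b) - ln (per c)| <= K * `|b - c|.
Proof.
move=> a0; have [d [K [d0 dK]]] := per_locally_lipschitz a0.
have k0 : 0 < per a / 2 by rewrite divr_gt0// per_gt0.
have [d' d'0 d'P] := near_per a0 k0.
exists (Num.min d d'), (K / (per a / 2)); split; first by rewrite lt_min d0.
move=> b c b0 c0; rewrite !lt_min => /andP[bd bd'] /andP[cd cd'].
have low s : 0 <= s -> `|s - a| < d' -> per a / 2 <= per s.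
  by move=> s0 sd; have := d'P s s0 sd; rewrite ltr_norml; lra.
apply: le_trans (ln_lipschitz k0 (low b b0 bd') (low c c0 cd')) _.
by rewrite mulrAC ler_wpM2r ?dK// invr_ge0 ltW.
Qed.

(** The contact-geometric estimate [period_variation], applied to the orbits [P s]
    near [P a] with [eps] a multiple of the distance from [s] to [a]. *)
Lemma log_per_variation (a k : R) : 0 < a -> (metric_derivative par a < k%:E)%E ->
  \forall s \near a, `|ln (per s) - ln (per a)| <= 2 * C * k * `|s - a|.
Proof.
move=> a0 /(metric_derivative_lt a0)[k1 k1k near_par].
have a0' := ltW a0.
have [e [L [e0 eL]]] := lip_P a0'.
pose Lc := `|L| + 1; have Lc0 : 0 < Lc by rewrite ltr_wpDl.
pose eps s := Lc * `|s - a|.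
have eps0 s : 0 <= eps s by rewrite mulr_ge0// ltW.
have eps_cvg : eps @ a --> (0 : R).
  have cs : s - a @[s --> a] --> a - a by apply: cvgB; [exact: cvg_id|exact: cvg_cst].
  have := cvgM (cvg_cst Lc) (cvg_norm cs); rewrite subrr normr0 mulr0; exact.
have pos : \forall s \near a, 0 <= s by exact: near_ge0.
have near_e : \forall s \near a, `|s - a| < e.
  exact: near_dist_lt.
have dist_s : \forall s \near a,
    [/\ (riemannian_dist g (orb a 0%R) (orb s 0%R) <= (L * `|s - a|)%:E)%E,
      `|per s - per a| <= L * `|s - a| & `|par s - par a| <= L * `|s - a|].
  apply: filterS (filterI pos near_e) => s [s0 se].
  have aae : `|a - a| < e by rewrite subrr normr0.
  have := orbit_dist_le (eL a s a0' s0 aae se).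
  by rewrite distrC (distrC _ (P s).1.2) (distrC _ (P s).2).
have LLc s : L * `|s - a| <= eps s.
  by rewrite ler_wpM2r//; apply: le_trans (ler_norm _) _; rewrite lerDl.
have par01 : 0 <= par a <= 1 by have [] := orbit_P_split a0'.
have [f [f0 sm_f reeb_f]] := reeb par01.
have [e1 e10 e1P] := log_lip par01.
have close_start : close_in (nbhs a) eps (orb a 0) (orb a 0) (fun s => orb s 0).
  have [r [K [r0 K0 rK]]] := riemannian_dist_chart (orb a 0) metric_g.
  exists K => //.
  have small : \forall s \near a, 1 * eps s < r by exact: (near_eps eps_cvg).
  apply: filterS (filterI dist_s small) => s [[ds _ _]]; rewrite mul1r => er.
  have [->|sa] := eqVneq s a.
    by rewrite subrr normr0 mulr_ge0//; split=> //; exact: mem_dom.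
  apply: rK; first exact: ltW.
  apply: le_lt_trans ds _; rewrite lte_fin ltr_pM2r; last by rewrite normr_gt0 subr_eq0.
  by apply: le_lt_trans (ler_norm _) _; rewrite ltrDl.
have per_a := per_gt0 a0'.
(* The slack between k1 and k absorbs the error term of period_variation. *)
pose eta := (k - k1) * C * per a / (2 * Lc).
have eta0 : 0 < eta by rewrite divr_gt0 ?mulr_gt0// subr_gt0.
have H := @period_variation R n M X smX R (nbhs a) _ eps eps0 eps_cvg (orb a) (per a) (par a)
  orb per par (orbit_P_split a0') _ _ _ close_start (fun x => f x *: lambda x) C sm_f reeb_f _ eta eta0.
have {}H : \forall s \near a, `|per s - per a| <= C * per s * `|par s - par a| + eta * eps s.
  apply: H.
  - by apply: filterS pos => s; exact: orbit_P_split.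
  - by apply: filterS dist_s => s [_ ps _]; apply: le_trans (LLc s).
  - by apply: filterS dist_s => s [_ _ ps]; apply: le_trans (LLc s).
  - have small : \forall s \near a, 1 * eps s < e1 by exact: (near_eps eps_cvg).
    apply: filterS (filterI pos (filterI dist_s small)) => s [s0 [[_ _ ps]]].
    rewrite mul1r => es x.
    have par_s : 0 <= par s <= 1 by have [] := orbit_P_split s0.
    have Hlip := e1P (par s) x par_s (le_lt_trans (le_trans ps (LLc s)) es).
    have [fX _] := reeb_f x; rewrite -[X in _ - X]fX !pairingZ -mulrBr normrM (gtr0_norm (f0 x)).
    apply: le_trans (ler_wpM2l (ltW (f0 x)) Hlip) _.
    by rewrite mulrCA -pairingZ fX mulr1.
have k0 : 0 < per a / 2 by rewrite divr_gt0.
have [d d0 dP] := near_per a0' (divr_gt0 per_a (ltr0n _ 3)).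
have near_d : \forall s \near a, `|s - a| < d.
  exact: near_dist_lt.
apply: filterS (filterI (filterI H near_par) (filterI pos near_d)) => s [[Hs qs] [s0 sd]].
have per_s := dP s s0 sd; rewrite ltr_norml in per_s; have /andP[ps1 ps2] := per_s.
have pers0 : 0 < per s by lra.
have half : 0 < per s / 2 by rewrite divr_gt0.
have half_s : per s / 2 <= per s by lra.
have half_a : per s / 2 <= per a by lra.
apply: le_trans (ln_lipschitz half half_s half_a) _; rewrite ler_pdivrMr//.
have -> : 2 * C * k * `|s - a| * (per s / 2) = C * k * per s * `|s - a| by field.
have etaE : eta * eps s = (k - k1) * C * `|s - a| * (per a / 2).
  by rewrite /eta /eps; field; rewrite gt_eqF.
have Hq : C * per s * `|par s - par a| <= C * per s * (k1 * `|s - a|).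
  by rewrite ler_wpM2l// mulr_ge0// ltW.
have Hpa : (k - k1) * C * `|s - a| * (per a / 2) <= (k - k1) * C * `|s - a| * per s.
  by rewrite ler_wpM2l//; [rewrite !mulr_ge0 ?subr_ge0// ltW|lra].
apply: le_trans Hs _; rewrite etaE; apply: le_trans (lerD Hq Hpa) _.
by rewrite le_eqVlt; apply/orP; left; apply/eqP; ring.
Qed.

(** The bound |d (log p)| <= 2 C |dt|, integrated. *)
Lemma log_per_le_length b : 0 < b ->
  (`|ln (per b) / (2 * C) - ln (per 0) / (2 * C)|%:E <=
   \int[lebesgue_measure]_(a in `[0%R, +oo[) metric_derivative par a)%E.
Proof.
move=> b0; have C2 : 0 < 2 * C by rewrite mulr_gt0.
apply: (@le_trans _ _ (\int[lebesgue_measure]_(a in `]0%R, b[) metric_derivative par a)%E);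
  last first.
  apply: ge0_integral_mono => // [a|a|a]; rewrite /= !in_itv/= ?andbT.
  - by move=> /andP[/ltW ? _].
  - by move=> /andP[/ltW ? _]; exact: metric_derivative_ge0.
  - exact: metric_derivative_ge0.
apply: (@increment_le_integral R (fun s => ln (per s) / (2 * C))) => //.
- move=> t /andP[t0 tb]; have [d [K [d0 dK]]] := log_per_locally_lipschitz t0.
  exists d, (K / (2 * C)); split=> // x y /andP[x0 _] /andP[y0 _] xd yd.
  rewrite -mulrBl normrM (gtr0_norm (_ : 0 < (2 * C)^-1)) ?invr_gt0//.
  by rewrite mulrAC ler_wpM2r ?invr_ge0 ?(ltW C2)// dK.
- by move=> x /andP[/ltW x0 _]; exact: metric_derivative_ge0.
- move=> x /andP[x0 _] k /(log_per_variation x0); apply: filterS => s Hs.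
  rewrite -mulrBl normrM (gtr0_norm (_ : 0 < (2 * C)^-1)) ?invr_gt0//.
  by rewrite ler_pdivrMr// mulrC mulrA.
Qed.

Lemma finite_length_per_bounded : finite_length par ->
  exists B, forall tau, 0 <= tau -> per tau <= B.
Proof.
rewrite /finite_length; set len := (\int[_]_(_ in _) _)%E => len_fin.
have len0 : (0 <= len)%E.
  by apply: integral_ge0 => a; rewrite /= in_itv/= andbT; exact: metric_derivative_ge0.
case El : len len0 len_fin => [l| |]// l0 _; rewrite lee_fin in l0.
have C2 : 0 < 2 * C by rewrite mulr_gt0.
exists (expR (2 * C * l + ln (per 0))) => tau tau0.
rewrite -[leLHS]lnK ?posrE ?per_gt0// ler_expR.
move: tau0; rewrite le_eqVlt => /orP[/eqP<-|tau0]; first by rewrite lerDr mulr_ge0// ltW.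
have := log_per_le_length tau0; rewrite -/len El lee_fin -mulrBl => /(le_trans (ler_norm _)).
by rewrite ler_pdivrMr// lerBlDr mulrC.
Qed.

End PeriodGrowth.

Theorem theorem1p10 (R : realType) (m : nat) (M : manifold R m.*2.+1)
    (xi : M -> set 'rV[R]_(m.*2.+1)) (X : R -> M -> 'rV[R]_(m.*2.+1))
    (g : M -> 'M[R]_(m.*2.+1)) :
  compact [set: M] ->
  contact_structure xi ->
  reeb_homotopy xi X ->
  riemannian_metric g ->
  ~ exists p : R -> loop M * R * R,
      [/\ forall tau, 0 <= tau -> orbit_space X (p tau),
          locally_lipschitz (orbit_dist g) p,
          forall B : R, exists2 tau, 0 <= tau & B < (p tau).1.2
        & finite_length (fun tau => (p tau).2)].
Proof.
move=> cM _ [smX [lambda [[sm_lambda _] _ reebX]]] gm [p [orbit_p lip_p unbounded len_p]].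
have lambda_pos t x : 0 <= t <= 1 -> 0 < pairing (lambda x) (X t x).
  move=> /reebX[f [f0 _ reeb_f]]; have [fX _] := reeb_f x.
  have : 0 < f x * pairing (lambda x) (X t x).
    by rewrite -pairingZ fX.
  by rewrite pmulr_rgt0.
have [C C0 log_lip] := pairing_log_lipschitz smX sm_lambda lambda_pos cM.
have reeb t : 0 <= t <= 1 -> exists f : M -> R,
    [/\ forall x, 0 < f x, smooth_form_on [set: M] (fun x => f x *: lambda x) &
    forall x, pairing (f x *: lambda x) (X t x) = 1 /\
      forall v, dform (fun x => f x *: lambda x) x (X t x) v = 0].
  by move=> /reebX[f [f0 [sm_f _] reeb_f]]; exists f.
have [B PB] := finite_length_per_bounded smX gm C0 log_lip reeb orbit_p lip_p len_p.
have [tau tau0] := unbounded B.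
by rewrite ltNge PB.
Qed.
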